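(* Let $c>0$, and let $\mathfrak{X}=\mathfrak{X}_c$ and $G=G_c:\mathbb{R}\times\mathfrak{X}\to C_b(\mathbb{R})$ be as defined in the context. Then there exist $\delta,\delta_0>0$ such that for every $\eta\in(-\delta,\delta)$ there is exactly one $\varphi_\eta=\varphi_{\eta,c}\in\mathfrak{X}$ for which $\|\varphi_\eta\|_{\mathfrak{X}}\le\delta_0$ and $G(\eta,\varphi_\eta)=0$. Moreover, the mapping $\eta\mapsto\varphi_\eta$ is a $C^\infty$-map (with values in $\mathfrak{X}$) on a neighborhood of $0$.
   Context: $C_b(\mathbb{R})$ is the Banach space of bounded continuous real-valued functions on $\mathbb{R}$ with norm $\|\cdot\|_{L^\infty}$; $C_b^1(\mathbb{R})$ is the space of $f\in C^1(\mathbb{R})$ with $f,f'\in C_b(\mathbb{R})$, with norm $\|f\|_{C_b^1}=\|f\|_{L^\infty}+\|f'\|_{L^\infty}$. Nonlocal operator: with $\psi(x)=\chi_{(0,\infty)}(x)\,x^{-1/3}$, set $g[u]=\psi*\partial_x u$, i.e. $g[u](x)=\int_0^{+\infty}\xi^{-1/3}u'(x-\xi)\,d\xi$. For $\varphi\in C_b^1(\mathbb{R})$ this is understood (via integration by parts) as $$g[\varphi](x)=\int_0^1\frac{\varphi'(x-\xi)}{\xi^{1/3}}\,d\xi+\varphi(x-1)-\frac13\int_1^{+\infty}\frac{\varphi(x-\xi)}{\xi^{4/3}}\,d\xi,$$ and then $g[\varphi]\in C_b(\mathbb{R})$. For $c\in\mathbb{R}$ define $g_c(x)=c\big(1-\tanh(\tfrac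 c2x)\big)$, $h_c(x)=g_c'(x)=-\tfrac{c^2}{2}\operatorname{sech}^2(\tfrac c2x)$, and $\tau_c(x)=c-g_c(x)=c\tanh(\tfrac c2x)$. The function $g[g_c]=\psi*h_c$ belongs to $C_b(\mathbb{R})$. Define the Banach space $\mathfrak{X}=\mathfrak{X}_c=\{\varphi\in C_b^1(\mathbb{R}) : \int_{\mathbb{R}}\varphi'h_c'\,dx=0\}$ with norm $\|\cdot\|_{\mathfrak{X}}=\|\cdot\|_{C_b^1}$, and the map $G=G_c:\mathbb{R}\times\mathfrak{X}\to C_b(\mathbb{R})$, $$G(\eta,\varphi)=\tau_c\varphi-\frac{\varphi^2}{2}+\varphi'-\eta\,g[\varphi]-\eta\,g[g_c].$$ *)

(* Defs.v *)
From HB Require Import structures.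
From mathcomp Require Import all_boot all_order ssralg ssrnum ssrint interval.
From mathcomp Require Import ring lra.
From mathcomp Require Import all_classical all_reals all_analysis.
From mathcomp Require Import measurable_realfun.

Set Implicit Arguments.
Unset Strict Implicit.
Unset Printing Implicit Defensive.

Import Order.TTheory GRing.Theory Num.Theory.
Import numFieldNormedType.Exports.

Local Open Scope ring_scope.
Local Open Scope classical_set_scope.

Section hyperbolic.
Context {R : realType}.
Implicit Types x k : R.

Definition sinh x : R := (expR x - expR (- x)) / 2.
Definition cosh x : R := (expR x + expR (- x)) / 2.
Definition tanh x : R := sinh x / cosh x.
Definition sech x : R := (cosh x)^-1.

Lemma cosh_gt0 x : 0 < cosh x.
Proof. by rewrite divr_gt0// addr_gt0// expR_gt0. Qed.

Lemma cosh_neq0 x : cosh x != 0.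
Proof. by rewrite gt_eqF// cosh_gt0. Qed.

Lemma coshN x : cosh (- x) = cosh x.
Proof. by rewrite /cosh opprK addrC. Qed.

Lemma sqr_cosh_sinh x : cosh x ^+ 2 - sinh x ^+ 2 = 1.
Proof. by have := expRxMexpNx_1 x; rewrite /cosh /sinh; lra. Qed.

Lemma normr_tanh_le1 x : `|tanh x| <= 1.
Proof.
have c0 := cosh_gt0 x.
rewrite normrM normfV (gtr0_norm c0) ler_pdivrMr// mul1r.
rewrite -(@ler_pXn2r _ 2)// ?nnegrE ?normr_ge0 ?ltW//.
by rewrite real_normK ?num_real//; have := sqr_cosh_sinh x; lra.
Qed.

#[local] Instance is_derive_expRM k x :
  is_derive x (1:R) (fun y => expR (k * y)) (k * expR (k * x)).
Proof.
have d : is_derive x (1:R) (fun y => k * y) k.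
  have := @is_deriveZ _ _ _ id k x 1 1 _; rewrite [k *: 1]mulr1; exact.
by have := @is_derive1_comp _ expR (fun y => k * y) x _ _ (is_derive_expR _) d;
  rewrite mulrC.
Qed.

Lemma coshM_E k : (fun y => cosh (k * y)) =
  2^-1 \*: ((fun y => expR (k * y)) + (fun y => expR (- k * y))).
Proof.
by apply/funext => y; rewrite /cosh -mulNr mulrC.
Qed.

Lemma sinhM_E k : (fun y => sinh (k * y)) =
  2^-1 \*: ((fun y => expR (k * y)) - (fun y => expR (- k * y))).
Proof.
by apply/funext => y; rewrite /sinh -mulNr mulrC.
Qed.

Lemma is_derive_coshM k x :
  is_derive x (1:R) (fun y => cosh (k * y)) (k * sinh (k * x)).
Proof.
rewrite coshM_E; apply: is_derive_eq.
by rewrite /sinh/GRing.scale/= !mulNr; lra.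
Qed.

Lemma is_derive_sinhM k x :
  is_derive x (1:R) (fun y => sinh (k * y)) (k * cosh (k * x)).
Proof.
rewrite sinhM_E; apply: is_derive_eq.
by rewrite /cosh/GRing.scale/= !mulNr; lra.
Qed.

Lemma is_derive_sechM k x :
  is_derive x (1:R) (fun y => sech (k * y))
    (- k * (sech (k * x) * tanh (k * x))).
Proof.
have d := is_derive_coshM k x.
have c0 := cosh_neq0 (k * x).
apply: (is_derive_eq (@is_deriveV _ (fun y => cosh (k * y)) _ _ _ c0 d)).
by rewrite /sech /tanh /GRing.scale/=; field.
Qed.

Lemma is_derive_tanhM k x :
  is_derive x (1:R) (fun y => tanh (k * y)) (k * sech (k * x) ^+ 2).
Proof.
have ds := is_derive_sechM k x.
have dh := is_derive_sinhM k x.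
have -> : (fun y => tanh (k * y)) =
  (fun y => sinh (k * y)) * (fun y => sech (k * y)) :> (R -> R) by [].
apply: (is_derive_eq (is_deriveM dh ds)).
rewrite /GRing.scale/= /tanh /sech.
have := sqr_cosh_sinh (k * x); have := cosh_neq0 (k * x).
move: (cosh _) (sinh _) => C S C0 CS.
rewrite -[X in _ = k * X]mulr1 -CS.
by field.
Qed.

End hyperbolic.

Section sech2_integrable.
Context {R : realType}.
Local Notation mu := (@lebesgue_measure R).

Lemma continuous_sechM (k : R) : continuous (fun x => sech (k * x)).
Proof.
move=> x; apply/differentiable_continuous/derivable1_diffP.
by have [] := is_derive_sechM k x.
Qed.

Lemma continuous_sech2M (k : R) : continuous (fun x => sech (k * x) ^+ 2).
Proof.
have -> : (fun x => sech (k * x) ^+ 2) =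
  (fun x => sech (k * x)) \* (fun x => sech (k * x)) by [].
by move=> x; apply: continuousM; exact: continuous_sechM.
Qed.

Lemma cvg_tanhM_pinfty (k : R) : 0 < k ->
  (tanh (k * x) @[x --> +oo] --> (1 : R)).
Proof.
move=> k0.
have -> : (fun x => tanh (k * x)) =
   (fun x => (1 - expR (- (2 * k * x))) * (1 + expR (- (2 * k * x)))^-1).
  apply/funext => x; rewrite /tanh /sinh /cosh.
  have -> : 2 * k * x = k * x + k * x by ring.
  rewrite opprD expRD expRN.
  have : 0 < expR (k * x) by exact: expR_gt0.
  move: (expR _) => e e0.
  by field; rewrite !gt_eqF// addr_gt0// mulr_gt0.
have e0 : expR (- (2 * k * x)) @[x --> +oo] --> (0 : R).
  have k2 : 0 < 2 * k by rewrite mulr_gt0.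
  apply: (@cvg_comp _ _ _ (fun x => 2 * k * x) (fun y => expR (- y)) _
    (pinfty_nbhs R)); last exact: cvgr_expR.
  exact: gt0_cvgMry.
have h : (1 - 0) * (1 + 0)^-1 = 1 :> R by rewrite subr0 addr0 mul1r invr1.
have := cvgM (cvgB (cvg_cst (1 : R)) e0)
  (cvgV _ (cvgD (cvg_cst (1 : R)) e0)).
by rewrite h; apply; rewrite addr0.
Qed.

Lemma integrable_sech2M (k : R) : k != 0 ->
  mu.-integrable setT (EFin \o (fun x => sech (k * x) ^+ 2)).
Proof.
wlog k0 : k / 0 < k => [hwlog kN0|_].
  have [k0|k0|k0] := ltgtP 0 k; first exact: hwlog.
    have := hwlog (- k); rewrite oppr_gt0 oppr_eq0 => /(_ k0 kN0).
    by under eq_fun do rewrite /sech mulNr coshN.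
  by rewrite -k0 eqxx in kN0.
have cs := @continuous_sech2M k.
apply/integrableP; split.
  by apply/measurable_EFinP; exact: continuous_measurable_fun.
under eq_integral do rewrite /= ger0_norm ?sqr_ge0//.
rewrite ge0_symfun_integralT//; last 2 first.
- by move=> x; exact: sqr_ge0.
- by move=> x; rewrite /= /sech mulrN coshN.
have -> : [set x : R | 0 <= x] = `[0, +oo[%classic.
  by apply/seteqP; split => x/=; rewrite in_itv/= andbT.
have dF x : is_derive x (1 : R) (k^-1 \*: (fun y : R => tanh (k * y)))
    (sech (k * x) ^+ 2).
  apply: (is_derive_eq (is_deriveZ _ (is_derive_tanhM k x))).
  by rewrite /GRing.scale/= mulKf// gt_eqF.
rewrite (@ge0_continuous_FTC2y _ _ (k^-1 \*: (fun y : R => tanh (k * y))) _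
  (k^-1 *: 1))//.
- by rewrite -EFinB -EFinM ltry.
- by move=> x _; exact: sqr_ge0.
- exact: continuous_subspaceT.
- by apply: cvgZr; exact: cvg_tanhM_pinfty.
- apply: cvg_at_right_filter.
  by apply/differentiable_continuous/derivable1_diffP; have [] := dF 0.
- by move=> x _; rewrite derive1E derive_val.
Qed.

End sech2_integrable.

Section wave.
Context {R : realType}.
Local Notation mu := (@lebesgue_measure R).
Implicit Types (c x eta : R) (u v : R -> R).

Definition gc c x : R := c * (1 - tanh (c / 2 * x)).
Definition hc c : R -> R := (gc c)^`().
Definition tauc c x : R := c - gc c x.

Lemma hcE c x : hc c x = - (c ^+ 2 / 2) * sech (c / 2 * x) ^+ 2.
Proof.
rewrite /hc derive1E.
have -> : gc c = c \*: (cst 1 - (fun y => tanh (c / 2 * y))) by [].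
have dt := is_derive_tanhM (c / 2) x.
rewrite derive_val /GRing.scale/= sub0r; lra.
Qed.

Lemma taucE c x : tauc c x = c * tanh (c / 2 * x).
Proof. by rewrite /tauc /gc; ring. Qed.

Lemma is_derive_hc c x : is_derive x (1 : R) (hc c)
  (c ^+ 3 / 2 * (sech (c / 2 * x) ^+ 2 * tanh (c / 2 * x))).
Proof.
have -> : hc c = - (c ^+ 2 / 2) \*: ((fun y => sech (c / 2 * y)) ^+ 2).
  by apply/funext => y; rewrite hcE.
have ds := is_derive_sechM (c / 2) x.
by apply: is_derive_eq; rewrite /GRing.scale/=; field.
Qed.

Lemma integrable_derive1_hc c : mu.-integrable setT (EFin \o (hc c)^`()).
Proof.
have [->|c0] := eqVneq c 0.
  rewrite (_ : EFin \o _ = cst 0%E); first exact: integrable0.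
  apply/funext => x /=; congr EFin; rewrite derive1E.
  have d := is_derive_hc 0 x.
  by rewrite derive_val; lra.
have k0 : c / 2 != 0 by rewrite mulf_neq0// invr_neq0.
have -> : EFin \o (hc c)^`() =
    ((EFin \o (fun x => c ^+ 3 / 2 * tanh (c / 2 * x))%R)
     \* (EFin \o (fun x => sech (c / 2 * x) ^+ 2)%R))%E.
  apply/funext => x /=; rewrite -EFinM; congr EFin; rewrite derive1E.
  by have d := is_derive_hc c x; rewrite derive_val; ring.
apply: integrableMr => //; last exact: integrable_sech2M.
- apply: continuous_measurable_fun => x.
  apply: (@continuousM _ _ (cst (c ^+ 3 / 2)) (fun y => tanh (c / 2 * y))).
    exact: cvg_cst.
  apply/differentiable_continuous/derivable1_diffP.
  by have [] := is_derive_tanhM (c / 2) x.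
- exists `|c ^+ 3 / 2|; split => [|M cM x _]; first exact: num_real.
  rewrite /= normrM (le_trans _ (ltW cM))// ler_piMr//.
  exact: normr_tanh_le1.
Qed.

Definition Cb u : Prop := continuous u /\ bounded_fun u.

Definition Cb1 u : Prop := [/\ forall x, derivable u x 1, Cb u & Cb u^`()].

(* A genuine supremum only for bounded [u]; [sup] is 0 on unbounded sets. *)
Definition Linfty_norm u : R := sup (range (fun x => `|u x|)).

Definition Cb1_norm u : R := Linfty_norm u + Linfty_norm u^`().

Lemma Linfty_norm_ub u x : bounded_fun u -> `|u x| <= Linfty_norm u.
Proof.
move=> [M [Mr uM]]; apply: ub_le_sup; last by exists x.
by exists (M + 1) => _ [y _ <-]; apply: uM => //; rewrite ltrDl.
Qed.

Lemma Linfty_norm_le u (M : R) : (forall x, `|u x| <= M) -> Linfty_norm u <= M.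
Proof.
by move=> uM; apply: ge_sup; [exists `|u 0|, 0|move=> _ [x _ <-]].
Qed.

Lemma Linfty_norm_ge0 u : bounded_fun u -> 0 <= Linfty_norm u.
Proof. by move=> bu; apply: le_trans (Linfty_norm_ub 0 bu). Qed.

Lemma Linfty_normD u v : bounded_fun u -> bounded_fun v ->
  Linfty_norm (u + v) <= Linfty_norm u + Linfty_norm v.
Proof.
move=> bu bv; apply: Linfty_norm_le => x; apply: le_trans (ler_normD _ _) _.
by apply: lerD; exact: Linfty_norm_ub.
Qed.

Lemma bounded_funZ (a : R) u : bounded_fun u -> bounded_fun (a *: u).
Proof.
move=> bu; exists (`|a| * Linfty_norm u); split => [|M aM x _].
  exact: num_real.
rewrite /= normrM (le_trans _ (ltW aM))// ler_wpM2l//.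
exact: Linfty_norm_ub.
Qed.

Lemma Linfty_normZ (a : R) u : bounded_fun u ->
  Linfty_norm (a *: u) = `|a| * Linfty_norm u.
Proof.
move=> bu.
have le b v : bounded_fun v -> Linfty_norm (b *: v) <= `|b| * Linfty_norm v.
  move=> bv; apply: Linfty_norm_le => x; rewrite normrM ler_wpM2l//.
  exact: Linfty_norm_ub.
apply/eqP; rewrite eq_le le//=.
have [->|a0] := eqVneq a 0.
  by rewrite normr0 mul0r Linfty_norm_ge0//; exact: bounded_funZ.
rewrite -ler_pdivlMl ?normr_gt0// -normfV.
rewrite -{1}[u](scalerK a0); apply: le; exact: bounded_funZ.
Qed.

Lemma derive1D u v : (forall x, derivable u x 1) ->
  (forall x, derivable v x 1) -> (u + v)^`() = u^`() + v^`().
Proof.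
by move=> du dv; apply/funext => x; rewrite derive1E deriveD// -!derive1E.
Qed.

Lemma derive1Z (a : R) u : (forall x, derivable u x 1) ->
  (a *: u)^`() = a *: u^`().
Proof.
by move=> du; apply/funext => x; rewrite derive1E deriveZ// -!derive1E.
Qed.

Lemma derive1_0 : (0 : R -> R)^`() = 0.
Proof. by apply/funext => x; rewrite derive1_cst. Qed.

Lemma Cb0 : Cb 0.
Proof.
split; first by move=> x; exact: cvg_cst.
exists 0; split => // M M0 x _.
by change (`|0 : R| <= M); rewrite normr0 ltW.
Qed.

Lemma CbZD (a : R) u v : Cb u -> Cb v -> Cb (a *: u + v).
Proof.
move=> [cu bu] [cv bv]; split; last exact: bounded_funD (bounded_funZ _ bu) bv.
move=> x; apply: (@continuousD _ _ _ (a *: u) v); last exact: cv.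
by apply: (@continuousM _ _ (cst a) u); [exact: cvg_cst|exact: cu].
Qed.

Lemma derivableZD (a : R) u v : (forall x, derivable u x 1) ->
  (forall x, derivable v x 1) -> forall x, derivable (a *: u + v) x 1.
Proof.
by move=> du dv x; apply: derivableD => //; exact: derivableZ.
Qed.

Lemma Cb1_0 : Cb1 0.
Proof.
split; [by move=> x; exact: derivable_cst|exact: Cb0|].
by rewrite derive1_0; exact: Cb0.
Qed.

Lemma derive1ZD (a : R) u v : (forall x, derivable u x 1) ->
  (forall x, derivable v x 1) -> (a *: u + v)^`() = a *: u^`() + v^`().
Proof.
move=> du dv; rewrite derive1D// ?derive1Z//.
by move=> x; exact: derivableZ.
Qed.

Lemma Cb1ZD (a : R) u v : Cb1 u -> Cb1 v -> Cb1 (a *: u + v).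
Proof.
move=> [du bu bu'] [dv bv bv']; split.
- exact: derivableZD.
- exact: CbZD.
- by rewrite derive1ZD//; exact: CbZD.
Qed.

(* The integrand is integrable for [u] in C_b^1, see [integrable_orth]. *)
Definition orth c u : R := \int[mu]_x (u^`() x * (hc c)^`() x).

Lemma integrable_orth c u : Cb1 u ->
  mu.-integrable setT (EFin \o (fun x => u^`() x * (hc c)^`() x)).
Proof.
move=> [_ _ [cu bu]].
have -> : EFin \o (fun x => u^`() x * (hc c)^`() x) =
    ((EFin \o u^`()) \* (EFin \o (hc c)^`()))%E by [].
apply: integrableMr => //.
  exact: continuous_measurable_fun.
exact: integrable_derive1_hc.
Qed.

Lemma orthZD c (a : R) u v : Cb1 u -> Cb1 v ->
  orth c (a *: u + v) = a * orth c u + orth c v.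
Proof.
move=> Cu Cv; have [du _ _] := Cu; have [dv _ _] := Cv.
have iu := integrable_orth c Cu; have iv := integrable_orth c Cv.
rewrite /orth -RintegralZl// -RintegralD//; last first.
  by have := integrableZl measurableT a iu.
apply: eq_Rintegral => x _; rewrite derive1ZD//.
by rewrite mulrA -mulrDl.
Qed.

End wave.

Section solution_space.
Context {R : realType} (c : R).
Implicit Types u v : R -> R.

(* Boolean because the subtype mechanism needs it: [in_XP] is the reflection. *)
Definition in_X : {pred R -> R} := [pred u | `[< Cb1 u /\ orth c u = 0 >]].

Lemma in_XP u : reflect (Cb1 u /\ orth c u = 0) (u \in in_X).
Proof. exact: asboolP. Qed.

Lemma in_X_submod_closed : submod_closed in_X.
Proof.
split.
  apply/in_XP; split; first exact: Cb1_0.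
  rewrite /orth derive1_0.
  under eq_Rintegral do rewrite mul0r.
  by rewrite Rintegral_cst// mul0r.
move=> a u v /in_XP[Cu ou] /in_XP[Cv ov]; apply/in_XP; split.
  exact: Cb1ZD.
by rewrite orthZD// ou ov mulr0 addr0.
Qed.

HB.instance Definition _ :=
  GRing.isSubmodClosed.Build R (R -> R) in_X in_X_submod_closed.

Record X : Type := MkX { X_fun :> R -> R ; _ : X_fun \in in_X }.

HB.instance Definition _ := [isSub for X_fun].
HB.instance Definition _ := [Choice of X by <:].
HB.instance Definition _ := [SubChoice_isSubLmodule of X by <:].

Implicit Types p q : X.

Lemma X_funD p q : (p + q : X) = (p : R -> R) + q :> (R -> R).
Proof. exact: (raddfD (val : X -> R -> R)). Qed.

Lemma X_funZ (a : R) p : (a *: p : X) = a *: (p : R -> R) :> (R -> R).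
Proof. exact: GRing.valZ. Qed.

Lemma X_Cb1 p : Cb1 p.
Proof. by have /in_XP[] := valP p. Qed.

Let X_norm p : R := Cb1_norm p.

Let X_normD p q : X_norm (p + q) <= X_norm p + X_norm q.
Proof.
have [dp [_ bp] [_ bp']] := X_Cb1 p; have [dq [_ bq] [_ bq']] := X_Cb1 q.
rewrite /X_norm /Cb1_norm X_funD derive1D// addrACA.
by rewrite lerD// Linfty_normD.
Qed.

Let X_normZ (a : R) p : X_norm (a *: p) = `|a| * X_norm p.
Proof.
have [dp [_ bp] [_ bp']] := X_Cb1 p.
rewrite /X_norm /Cb1_norm X_funZ derive1Z//.
by rewrite !Linfty_normZ// mulrDr.
Qed.

Let X_norm_eq0 p : X_norm p = 0 -> p = 0.
Proof.
have [_ [_ bp] [_ bp']] := X_Cb1 p => /eqP.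
rewrite paddr_eq0 ?Linfty_norm_ge0// => /andP[/eqP p0 _].
apply/val_inj/funext => x; apply/eqP; rewrite -normr_le0.
by rewrite -[leRHS]p0; exact: Linfty_norm_ub.
Qed.

HB.instance Definition _ :=
  Lmodule_isNormed.Build R X X_normD X_normZ X_norm_eq0.

Lemma X_normE p : `|p| = Cb1_norm p.
Proof. by []. Qed.

End solution_space.

Section equation.
Context {R : realType}.
Local Notation mu := (@lebesgue_measure R).
Implicit Types (c x eta : R) (u v phi : R -> R).

Definition convolution u v x : R := \int[mu]_y (u y * v (x - y)).

Definition psi x : R := \1_(`]0, +oo[%classic : set R) x * x `^ (- (1 / 3)).

(* [convolution psi phi^`()] after integrating by parts over [1, +oo[, so that
   it makes sense for every [phi] in C_b^1. Both integrals then converge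
   absolutely. At [xi = 0] the first integrand has the junk value 0, on a
   null set. *)
Definition gop phi x : R :=
  \int[mu]_(xi in `[0, 1]) (phi^`() (x - xi) / xi `^ (1 / 3))
  + phi (x - 1)
  - 1 / 3 * \int[mu]_(xi in `[1, +oo[) (phi (x - xi) / xi `^ (4 / 3)).

(* The nonlocal term at [gc c] is written as [convolution psi (hc c)], which
   converges absolutely because [hc c] decays exponentially. *)
Definition G c eta phi x : R :=
  tauc c x * phi x - phi x ^+ 2 / 2 + phi^`() x
  - eta * gop phi x - eta * convolution psi (hc c) x.

End equation.

(* C^oo on an open set [U]. The derivatives are limits in the norm of [V], and
   each one is continuous on [U] since it is itself derivable there. *)
Definition smooth_on (R : realType) (V : normedModType R) (U : set R)
    (f : R -> V) : Prop :=
  forall (n : nat) (x : R), U x -> derivable (f^`(n)) x 1.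

(* Main.v *)
Require Import Defs.
From mathcomp Require Import all_boot all_order ssralg ssrnum ssrint interval archimedean.
From mathcomp Require Import ring lra.
From mathcomp Require Import all_classical all_reals all_analysis.
From mathcomp Require Import measurable_realfun.
From HB Require Import structures.

Import Order.TTheory GRing.Theory Num.Theory.
Import numFieldNormedType.Exports.

(** For small [eta] the equation [G eta phi = 0] is a small perturbation of the
    linear equation [tauc * phi + phi' = 0], and the orthogonality condition
    built into [X c] is what makes this linear operator [linearization]
    invertible. It solves the first order equation [phi' + tauc * phi = f] by
    variation of constants: the homogeneous solutions are the multiples of
    [sech2], i.e. of [hc], the growth of [cosh ^ 2] in both directions keeps
    the particular solution bounded, and since the pairing [orth] of [sech2]
    is not zero exactly one of the bounded solutions lies in [X c]
    ([linearization_solvable], [linearization_inj]).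

    The other terms of [G] take values in bounded continuous functions: [gop]
    is a sum of two convolutions with integrable kernels ([Cb_gop], [gop_le]),
    and an integration by parts turns [convolution psi (hc c)] into [gop] of a
    C_b^1 function ([wave_convolutionE]). Applying the inverse of
    [linearization] to [G eta phi = 0] therefore gives an equation

      [phi = B phi phi + eta *: A phi + eta *: K]

    in [X c], with [B] bounded bilinear and [A] bounded linear ([G_eq0P]).
    The space [X c] is complete since it is isomorphic, through
    [linearization], to the bounded continuous functions ([X_complete]).

    In any Banach space such an equation has for small [eta] a unique small
    solution, which is a smooth function of [eta] ([quadratic_branch]).
    Existence and uniqueness are the contraction principle. Differentiating
    the equation shows that the derivative of the branch [phi] solves the
    linear equation [u = w + 2 B phi u + eta *: A u] with
    [w = A phi + K], and that the solution operator of that linear equation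
    has a derivative expressed through itself, so that smoothness follows by a
    bootstrap on the order of differentiation. *)

Set Implicit Arguments.
Unset Strict Implicit.
Unset Printing Implicit Defensive.

Local Open Scope ring_scope.
Local Open Scope classical_set_scope.

(** * The quadratic fixed point equation in a Banach space *)

Section fixpoint.
Context (R : realType) (V : completeNormedModType R).

Lemma halving_fixpoint (U : set V) (f : V -> V) :
  closed U -> U !=set0 -> (forall x, U x -> U (f x)) ->
  (forall x y, U x -> U y -> `|f x - f y| <= 2^-1 * `|x - y|) ->
  exists2 p, U p & p = f p.
Proof.
move=> cU U0 fU fl.
have fF : set_fun U U f by move=> x; exact: fU.
pose F : {fun U >-> U} := HB.pack f (isFun.Build _ _ _ _ _ fF).
apply: (@banach_fixed_point _ _ _ F) => //.
exists (2^-1)%:nng; split; first by rewrite /= invf_lt1// ltr1n.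
by move=> [x y] [/= Ux Uy]; exact: fl.
Qed.

End fixpoint.

Section smooth_chain.
Context {R : realType} {V : normedModType R} (U : set R).
Hypothesis oU : open U.

(** The successive derivatives are prescribed on [U] only, hence the notion
    depends only on the values of [u] on [U] ([smooth_chain_eq]), unlike the
    iterated derivatives of functions defined on the whole line. *)
Fixpoint smooth_chain (n : nat) (u : R -> V) : Prop :=
  if n is m.+1 then
    exists u' : R -> V, (forall x, U x -> is_derive x 1 u (u' x)) /\
      smooth_chain m u'
  else True.

Lemma smooth_chain_eq n (u v : R -> V) : {in U, u =1 v} ->
  smooth_chain n u -> smooth_chain n v.
Proof.
case: n => //= n uv [u' [du su]]; exists u'; split=> // x Ux.
apply: near_eq_is_derive (du x Ux).
by near=> y; apply/uv/mem_set; near: y; exact: open_nbhs_nbhs.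
Unshelve. all: by end_near. Qed.

Lemma smooth_chainW n (u : R -> V) : smooth_chain n.+1 u -> smooth_chain n u.
Proof.
elim: n u => //= n IH u [u' [du [u'' [du' su]]]]; exists u'; split=> //.
by apply: IH; exists u''.
Qed.

Lemma smooth_chain_derivable n (u : R -> V) : smooth_chain n.+1 u ->
  forall x, U x -> derivable (u^`(n)) x 1.
Proof.
elim: n u => [|n IH] u [u' [du su]] x Ux.
  by rewrite derive1n0; have [] := du x Ux.
rewrite derive1Sn; apply: IH => //; apply: (@smooth_chain_eq n.+1 u') => // y /set_mem Uy.
by have d := du y Uy; rewrite derive1E derive_val.
Qed.

Lemma smooth_chainD n (u v : R -> V) : smooth_chain n u -> smooth_chain n v ->
  smooth_chain n (u \+ v).
Proof.
elim: n u v => //= n IH u v [u' [du su]] [v' [dv sv]].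
exists (u' \+ v'); split; last exact: IH.
by move=> x Ux; apply: is_deriveD; [exact: du|exact: dv].
Qed.

Lemma smooth_chain_cst n (v : V) : smooth_chain n (fun=> v).
Proof.
elim: n v => //= n IH v; exists (fun=> 0); split=> // x _.
exact: is_derive_cst.
Qed.

End smooth_chain.

Lemma is_deriveP (R : realType) (V : normedModType R) (u : R -> V) (x : R) (d : V) :
  is_derive x 1 u d <-> h^-1 *: (u (h + x) - u x) @[h --> 0^'] --> d.
Proof.
have E : (fun h => h^-1 *: (u (h + x) - u x)) =
         (fun h => h^-1 *: ((u \o shift x) (h *: 1) - u x)).
  by apply/funext => h /=; rewrite /shift/= [h *: 1]mulr1.
rewrite E; split=> [[du <-]|H]; first exact: du.
by split; [apply/cvg_ex; exists d|exact: cvg_lim].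
Qed.

Lemma cvg_dnbhs0 (R : realType) : h @[h --> 0^'] --> (0 : R).
Proof. exact: cvg_within. Qed.

Lemma shift_cvg (R : realType) (x : R) : h + x @[h --> 0^'] --> x.
Proof.
rewrite -[X in _ --> X]add0r; apply: cvgD; last exact: cvg_cst.
exact: cvg_dnbhs0.
Qed.

Lemma is_derive_shift_cvg (R : realType) (V : normedModType R) (u : R -> V) (x : R)
  (d : V) : is_derive x 1 u d -> u (h + x) @[h --> 0^'] --> u x.
Proof.
move=> [/derivable1_diffP/differentiable_continuous cu _].
apply: (@cvg_comp _ _ _ (fun h => h + x) u _ (nbhs x)); last exact: cu.
exact: shift_cvg.
Qed.

(** The equation studied here is [u = B u u + e *: A u + e *: b]. *)
Section quadratic_branch.
Context (R : realType) (V : completeNormedModType R).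
Context (B : V -> V -> V) (A : V -> V) (b : V) (beta alpha : R).
Hypothesis BC : forall u v, B u v = B v u.
Hypothesis BD : forall u v w, B u (v + w) = B u v + B u w.
Hypothesis BZ : forall u (a : R) v, B u (a *: v) = a *: B u v.
Hypothesis beta0 : 0 < beta.
Hypothesis B_le : forall u v, `|B u v| <= beta * `|u| * `|v|.
Hypothesis AD : forall u v, A (u + v) = A u + A v.
Hypothesis AZ : forall (a : R) u, A (a *: u) = a *: A u.
Hypothesis alpha0 : 0 < alpha.
Hypothesis A_le : forall u, `|A u| <= alpha * `|u|.

Lemma A_sub u v : A (u - v) = A u - A v.
Proof. by rewrite AD -scaleN1r AZ scaleN1r. Qed.

Lemma B_subr u v w : B u (v - w) = B u v - B u w.
Proof. by rewrite BD -scaleN1r BZ scaleN1r. Qed.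

Lemma B_addl u v w : B (u + v) w = B u w + B v w.
Proof. by rewrite !(BC _ w) BD. Qed.

Lemma B_subl u v w : B (u - v) w = B u w - B v w.
Proof. by rewrite !(BC _ w) B_subr. Qed.

Lemma B_scalel (a : R) u w : B (a *: u) w = a *: B u w.
Proof. by rewrite !(BC _ w) BZ. Qed.

Lemma B_0l u : B 0 u = 0.
Proof. by rewrite -(scale0r 0) B_scalel !scale0r. Qed.

Lemma cvgA {T} (F : set_system T) {FF : Filter F} (u : T -> V) l :
  u x @[x --> F] --> l -> A (u x) @[x --> F] --> A l.
Proof.
move=> ul; apply/cvgrPdist_le => e e0.
have /cvgrPdist_le/(_ (e / alpha)) := ul.
rewrite divr_gt0// => /(_ isT); apply: filterS => x h.
by rewrite -A_sub (le_trans (A_le _))// mulrC -ler_pdivlMr.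
Qed.

Lemma cvgB2 {T} (F : set_system T) {FF : Filter F} (u v : T -> V) l m :
  u x @[x --> F] --> l -> v x @[x --> F] --> m ->
  B (u x) (v x) @[x --> F] --> B l m.
Proof.
move=> ul vm.
have -> : (fun x => B (u x) (v x)) =
    (fun x => B (u x - l) (v x) + B l (v x - m) + B l m).
  by apply/funext => x; rewrite B_subl B_subr !addrA !subrK.
rewrite -[X in _ --> X]add0r; apply: cvgD; last exact: cvg_cst.
rewrite -[X in _ --> X]add0r; apply: cvgD; apply/norm_cvg0P.
  have H : beta * `|u x - l| * `|v x| @[x --> F] --> beta * 0 * `|m|.
    apply: cvgM; last exact: cvg_norm.
    apply: cvgM; first exact: cvg_cst.
    by apply/norm_cvg0P/subr_cvg0.
  rewrite mulr0 mul0r in H.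
  by apply: (squeeze_cvgr _ (cvg_cst 0) H); near=> x; rewrite normr_ge0 B_le.
have H : beta * `|l| * `|v x - m| @[x --> F] --> beta * `|l| * 0.
  apply: cvgM; first exact: cvg_cst.
  by apply/norm_cvg0P/subr_cvg0.
rewrite mulr0 in H.
by apply: (squeeze_cvgr _ (cvg_cst 0) H); near=> x; rewrite normr_ge0 B_le.
Unshelve. all: by end_near. Qed.


Section smooth_chain_linear.
Context (U : set R).

Lemma smooth_chainA n (u : R -> V) :
  smooth_chain U n u -> smooth_chain U n (A \o u).
Proof.
elim: n u => //= n IH u [u' [du su]]; exists (A \o u'); split; last exact: IH.
move=> x Ux; apply/is_deriveP; under eq_fun do rewrite -A_sub -AZ.
by apply: cvgA; apply/is_deriveP; exact: du.
Qed.

Lemma smooth_chainB n (u v : R -> V) : smooth_chain U n u -> smooth_chain U n v ->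
  smooth_chain U n (fun x => B (u x) (v x)).
Proof.
elim: n u v => //= n IH u v su1 sv1.
have /= su := smooth_chainW su1; have sv := smooth_chainW sv1.
have [u' [du su']] := su1; have [v' [dv sv']] := sv1.
exists ((fun x => B (u' x) (v x)) \+ (fun x => B (u x) (v' x))).
split; last by apply: smooth_chainD; exact: IH.
move=> x Ux; apply/is_deriveP.
have /is_deriveP du0 := du x Ux; have /is_deriveP dv0 := dv x Ux.
have cv : v (h + x) @[h --> 0^'] --> v x.
  exact: is_derive_shift_cvg (dv x Ux).
have -> : (fun h => h^-1 *: (B (u (h + x)) (v (h + x)) - B (u x) (v x))) =
   (fun h => B (h^-1 *: (u (h + x) - u x)) (v (h + x)) +
             B (u x) (h^-1 *: (v (h + x) - v x))).
  apply/funext => h; rewrite B_scalel BZ B_subl B_subr -scalerDr; congr (_ *: _).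
  by rewrite addrA subrK.
by apply: cvgD; apply: cvgB2 => //; exact: cvg_cst.
Qed.

End smooth_chain_linear.

Context (r delta : R).
Hypothesis r0 : 0 < r.
Hypothesis delta0 : 0 < delta.
Hypothesis beta_r : 8 * beta * r <= 1.
Hypothesis alpha_delta : 4 * alpha * delta <= 1.
Hypothesis b_delta : 2 * delta * `|b| <= r.

(** A difference [d] of two solutions satisfies a linear equation
    [d = q + linpart e g d], where [g] is a sum of two points of the ball of
    radius [r]. The smallness conditions make [linpart e g] a contraction. *)
Let linpart (e : R) (g u : V) : V := B g u + e *: A u.
Let U : set R := `]- delta, delta[.

Lemma linpart_half e g u : `|e| <= delta -> `|g| <= 2 * r ->
  `|linpart e g u| <= 2^-1 * `|u|.
Proof.
move=> ed gr; apply: le_trans (ler_normD _ _) _.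
have h1 : `|B g u| <= 4^-1 * `|u|.
  apply: le_trans (B_le _ _) _; rewrite ler_wpM2r//.
  by apply: (@le_trans _ _ (beta * (2 * r))); [rewrite ler_wpM2l// ltW|move: beta_r; lra].
have h2 : `|e *: A u| <= 4^-1 * `|u|.
  rewrite normrZ.
  apply: (@le_trans _ _ (delta * (alpha * `|u|))); first by rewrite ler_pM.
  rewrite mulrA ler_wpM2r//; move: alpha_delta; lra.
lra.
Qed.

Lemma linpartB e g u v : linpart e g (u - v) = linpart e g u - linpart e g v.
Proof. by rewrite /linpart B_subr A_sub scalerBr opprD addrACA. Qed.

Lemma linpartZ e g (a : R) u : linpart e g (a *: u) = a *: linpart e g u.
Proof. by rewrite /linpart BZ AZ scalerDr !scalerA mulrC. Qed.

Lemma linpart_bound e g p q : `|e| <= delta -> `|g| <= 2 * r ->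
  p = q + linpart e g p -> `|p| <= 2 * `|q|.
Proof.
move=> ed gr pE; have := linpart_half p ed gr.
have : `|p| <= `|q| + `|linpart e g p| by rewrite {1}pE ler_normD.
lra.
Qed.

Lemma linpart_unique e g p p' q : `|e| <= delta -> `|g| <= 2 * r ->
  p = q + linpart e g p -> p' = q + linpart e g p' -> p = p'.
Proof.
move=> ed gr pE pE'; apply/eqP; rewrite -subr_eq0 -normr_le0.
rewrite -[leRHS](mulr0 2) -[X in _ <= _ * X](@normr0 _ V).
apply: (linpart_bound ed gr); rewrite linpartB add0r {1}pE {1}pE'.
by rewrite opprD addrACA subrr add0r.
Qed.

Lemma linpart_solvable e g q : `|e| <= delta -> `|g| <= 2 * r ->
  exists p, p = q + linpart e g p.
Proof.
move=> ed gr.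
have [||//||p _ pE] := @halving_fixpoint _ _ setT (fun p => q + linpart e g p).
- exact: closedT.
- by exists 0.
- by move=> x y _ _; rewrite opprD addrACA subrr add0r -linpartB; exact: linpart_half.
- by exists p.
Qed.

(** Continuous dependence of the solution [p] of [p = q + linpart e g p] on
    [q], [g] and [e]. Every derivative below is computed with it: a difference
    quotient solves such an equation exactly, so only the data of the equation
    need to be passed to the limit. *)
Lemma linpart_cvg {T} (F : set_system T) {FF : Filter F} (p q g : T -> V) (e : T -> R)
    (p0 q0 g0 : V) (e0 : R) :
  (\forall t \near F, [/\ `|e t| <= delta, `|g t| <= 2 * r &
     p t = q t + linpart (e t) (g t) (p t)]) ->
  p0 = q0 + linpart e0 g0 p0 ->
  q t @[t --> F] --> q0 -> g t @[t --> F] --> g0 -> e t @[t --> F] --> e0 ->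
  p t @[t --> F] --> p0.
Proof.
move=> H p0E qq gg ee; apply/subr_cvg0/norm_cvg0P.
pose E t := (q t - q0) + (B (g t - g0) p0 + (e t - e0) *: A p0).
have cE : 2 * `|E t| @[t --> F] --> (0 : R).
  rewrite -[X in _ --> X](mulr0 2); apply: cvgM; first exact: cvg_cst.
  rewrite -(@normr0 _ V); apply: cvg_norm.
  rewrite -[X in _ --> X]addr0; apply: cvgD; first exact/subr_cvg0.
  rewrite -[X in _ --> X]addr0; apply: cvgD.
    by rewrite -(B_0l p0); apply: cvgB2; [exact/subr_cvg0|exact: cvg_cst].
  rewrite -(scale0r (A p0)); apply: cvgZ; [exact/subr_cvg0|exact: cvg_cst].
apply: (squeeze_cvgr _ (cvg_cst 0) cE); near=> t; rewrite normr_ge0/=.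
have [et gt pE] : [/\ `|e t| <= delta, `|g t| <= 2 * r &
     p t = q t + linpart (e t) (g t) (p t)] by near: t.
(* [p t - p0] solves the equation with data [E t], the defect of [p0]. *)
apply: (linpart_bound et gt); rewrite linpartB {1}pE {1}p0E /E /linpart B_subl scalerBl.
apply/eqP; rewrite -subr_eq0; apply/eqP.
move: (q t) (B (g t) _) (B (g t) _) (B g0 _) (e t *: A (p t)) (e t *: A p0) (e0 *: A p0).
move=> a1 a2 a3 a4 a5 a6 a7.
rewrite !opprD !opprK !addrA.
by rewrite (ACl ((1*7)*(2*13)*(3*14)*(8*4)*(10*5)*(12*6)*(15*9)*(16*11)))/= !subrr !addr0.
Unshelve. all: by end_near. Qed.

Let Phi (e : R) (u : V) : V := B u u + e *: A u + e *: b.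

Lemma PhiB e u v : Phi e u - Phi e v = linpart e (u + v) (u - v).
Proof.
rewrite /Phi /linpart !B_addl !B_subr (BC v u) A_sub scalerBr.
rewrite [X in _ = X + _]addrA subrK !opprD !addrA.
by rewrite (ACl ((1*4)*(2*5)*(3*6)))/= subrr addr0 addrA.
Qed.

Lemma normD_ball (u v : V) : `|u| <= r -> `|v| <= r -> `|u + v| <= 2 * r.
Proof. by move=> ur vr; have := ler_normD u v; lra. Qed.

Lemma Phi_ball e u : `|e| <= delta -> `|u| <= r -> `|Phi e u| <= r.
Proof.
move=> ed ur.
have -> : Phi e u = linpart e u u + e *: b by [].
apply: le_trans (ler_normD _ _) _.
have h1 : `|linpart e u u| <= 2^-1 * `|u| by apply: linpart_half => //; move: r0; lra.
have h2 : `|e *: b| <= delta * `|b| by rewrite normrZ ler_wpM2r.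
by move: b_delta; lra.
Qed.

Lemma small_solution e : `|e| <= delta -> exists2 u, `|u| <= r & u = Phi e u.
Proof.
move=> ed; apply: (@halving_fixpoint _ _ [set u | `|u| <= r]).
- have := @closed_comp V R (fun u => `|u|) [set x | x <= r].
  apply; last exact: closed_le.
  by move=> u _; exact: norm_continuous.
- by exists 0; rewrite /= normr0 ltW.
- by move=> u; exact: Phi_ball.
- move=> u v ur vr; rewrite PhiB; apply: linpart_half => //; exact: normD_ball.
Qed.

Lemma small_solution_unique e u v : `|e| <= delta -> `|u| <= r -> `|v| <= r ->
  u = Phi e u -> v = Phi e v -> u = v.
Proof.
move=> ed ur vr uE vE; apply/eqP; rewrite -subr_eq0; apply/eqP.
have uv := normD_ball ur vr.
apply: (linpart_unique (q := 0) ed uv); first by rewrite -PhiB add0r -uE -vE.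
by rewrite /linpart -(scale0r 0) BZ AZ !scale0r scaler0 !addr0.
Qed.

Section solution_branch.
Variable f : R -> V.
Hypothesis f_le : forall x, U x -> `|f x| <= r.
Hypothesis fE : forall x, U x -> f x = Phi x (f x).

Let oU : open U. Proof. exact: interval_open. Qed.

Let U_le x : U x -> `|x| <= delta.
Proof. by rewrite /U/= in_itv/= ler_norml => /andP[? ?]; rewrite !ltW. Qed.

Let nearU x : U x -> \forall h \near 0^', U (h + x).
Proof.
move=> Ux; have : nbhs x U by exact: open_nbhs_nbhs.
exact: (@shift_cvg R x).
Qed.

(** The linearization of the equation at the branch [f], inverted. *)
Let resolvent (x : R) (w : V) : V := get [set p | p = w + linpart x (f x + f x) p].

Lemma resolventE x w : U x ->
  resolvent x w = w + linpart x (f x + f x) (resolvent x w).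
Proof.
move=> Ux; have [p pE] := linpart_solvable w (U_le Ux) (normD_ball (f_le Ux) (f_le Ux)).
exact: (@getPex _ [set p | p = w + linpart x (f x + f x) p] (ex_intro _ p pE)).
Qed.

(** The increment of a quadratic map is linear in the increment of the
    argument, with coefficient the sum of the two arguments. Thus the quotients
    [(f (h + x) - f x) / h] solve a linear equation without remainder term. *)
Lemma branch_diff x h : U x -> U (h + x) ->
  f (h + x) - f x = h *: (A (f x) + b) + linpart (h + x) (f (h + x) + f x) (f (h + x) - f x).
Proof.
move=> Ux Uhx.
have -> : h *: (A (f x) + b) = Phi (h + x) (f x) - Phi x (f x).
  rewrite /Phi !scalerDl scalerDr !opprD !addrA.
  by rewrite (ACl ((2*4)*(1*6)*(3*7)*(5*8)))/= !subrr !addr0.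
by rewrite -PhiB -!fE// [RHS]addrC addrA subrK.
Qed.

Lemma branch_continuous x : U x -> f (h + x) @[h --> 0^'] --> f x.
Proof.
move=> Ux; apply/subr_cvg0/norm_cvg0P.
have cE : 2 * `|h *: (A (f x) + b)| @[h --> 0^'] --> (0 : R).
  rewrite -[X in _ --> X](mulr0 2); apply: cvgM; first exact: cvg_cst.
  rewrite -[X in _ --> X](@normr0 _ V); apply: cvg_norm.
  rewrite -[X in _ --> X](scale0r (A (f x) + b)).
  by apply: cvgZr_tmp; exact: cvg_dnbhs0.
apply: (squeeze_cvgr _ (cvg_cst 0) cE); near=> h; rewrite normr_ge0/=.
have Uhx : U (h + x) by near: h; exact: nearU.
apply: (linpart_bound (U_le Uhx) _ (branch_diff Ux Uhx)).
by apply: normD_ball; exact: f_le.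
Unshelve. all: by end_near. Qed.

Lemma branch_derive x : U x -> is_derive x 1 f (resolvent x (A (f x) + b)).
Proof.
move=> Ux; apply/is_deriveP.
apply: (@linpart_cvg _ _ _ _ (fun=> A (f x) + b) (fun h => f (h + x) + f x)
  (fun h => h + x) _ (A (f x) + b) (f x + f x) x); last first.
- exact: shift_cvg.
- by apply: cvgD; [exact: branch_continuous|exact: cvg_cst].
- exact: cvg_cst.
- exact: resolventE.
near=> h.
have Uhx : U (h + x) by near: h; exact: nearU.
have h0 : h != 0 by near: h; exact: nbhs_dnbhs_neq.
split; [exact: U_le|by apply: normD_ball; exact: f_le|].
by rewrite linpartZ {1}(branch_diff Ux Uhx) scalerDr scalerA mulVf// scale1r.
Unshelve. all: by end_near. Qed.

Lemma resolvent_diff w x h : U x -> U (h + x) ->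
  let u y := resolvent y (w y) in
  u (h + x) - u x = (w (h + x) - w x)
     + (B (f (h + x) - f x) (u x) + B (f (h + x) - f x) (u x))
     + h *: A (u x)
     + linpart (h + x) (f (h + x) + f (h + x)) (u (h + x) - u x).
Proof.
move=> Ux Uhx u; rewrite linpartB.
have uE y : U y -> linpart y (f y + f y) (u y) = u y - w y.
  by move=> Uy; apply/eqP; rewrite eq_sym subr_eq [X in _ == X]addrC -resolventE.
have -> : linpart (h + x) (f (h + x) + f (h + x)) (u x) =
  (u x - w x) + (B (f (h + x) - f x) (u x) + B (f (h + x) - f x) (u x)) + h *: A (u x).
  rewrite -uE// /linpart (B_addl (f x)) (B_addl (f (h + x)) (f _)) B_subl scalerDl.
  move: (B (f x) _) (B (f (h + x)) _) (h *: _) (x *: _) => a1 a2 a3 a4.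
  by rewrite !addrA [RHS](ACl ((4*6*8*3)*(1*5)*(2*7)))/= !subrr !addr0.
move: (B _ _ + B _ _) (h *: A _) => a1 a2.
rewrite uE// !opprD !opprK !addrA.
by rewrite [RHS](ACl ((5*7)*(1*6)*(2*8)*(3*9)*(4*10)))/= [_ + w _]addrC !subrr !addr0.
Qed.

(** The derivative of a resolvent is again a resolvent, of a right-hand side
    involving the derivative of [w], that of the branch, and the resolvent
    itself. *)
Lemma resolvent_derive w w' x : U x -> is_derive x 1 w w' ->
  let u y := resolvent y (w y) in
  let f' := resolvent x (A (f x) + b) in
  is_derive x 1 u (resolvent x (w' + (B f' (u x) + B f' (u x)) + A (u x))).
Proof.
move=> Ux dw u f'; apply/is_deriveP.
have /is_deriveP dw0 := dw; have /is_deriveP df0 := branch_derive Ux.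
have cf := branch_continuous Ux.
pose Df h := h^-1 *: (f (h + x) - f x).
apply: (@linpart_cvg _ _ _ _
  (fun h => h^-1 *: (w (h + x) - w x) + (B (Df h) (u x) + B (Df h) (u x)) + A (u x))
  (fun h => f (h + x) + f (h + x)) (fun h => h + x) _
  (w' + (B f' (u x) + B f' (u x)) + A (u x)) (f x + f x) x); last first.
- exact: shift_cvg.
- exact: cvgD.
- apply: cvgD; last exact: cvg_cst.
  by apply: cvgD => //; apply: cvgD; apply: cvgB2 => //; exact: cvg_cst.
- exact: resolventE.
near=> h.
have Uhx : U (h + x) by near: h; exact: nearU.
have h0 : h != 0 by near: h; exact: nbhs_dnbhs_neq.
split; [exact: U_le|by apply: normD_ball; exact: f_le|].
rewrite /Df !B_scalel linpartZ {1}(resolvent_diff w Ux Uhx) -/(u x) -/(u (h + x)).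
move: (w (h + x) - w x) (B _ (u x)) (linpart _ _ _) => a1 a2 a3.
by rewrite !scalerDr [_ *: (h *: _)]scalerA mulVf// scale1r.
Unshelve. all: by end_near. Qed.

(** Bootstrap: by [branch_derive] the derivative of [f] is the resolvent of
    [A \o f + b], so regularity of order [n] of [f] and of resolvents gives
    order [n.+1] for [f]; by [resolvent_derive] it then gives order [n.+1] for
    resolvents. Both claims have to be carried through the same induction. *)
Lemma branch_resolvent_smooth n : smooth_chain U n f /\
  forall w, smooth_chain U n w -> smooth_chain U n (fun x => resolvent x (w x)).
Proof.
elim: n => [//|n [fn rn]].
have f'n : smooth_chain U n (fun x => resolvent x (A (f x) + b)).
  apply: rn; apply: smooth_chainD; first exact: smooth_chainA.
  exact: smooth_chain_cst.
split; first by eexists; split; [exact: branch_derive|].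
move=> w wn1; have [w' [dw w'n]] := wn1.
have un := rn _ (smooth_chainW wn1).
eexists; split; first by move=> x Ux; exact: (resolvent_derive Ux (dw x Ux)).
apply: rn; apply: smooth_chainD; last exact: smooth_chainA.
by apply: smooth_chainD => //; apply: smooth_chainD; exact: smooth_chainB.
Qed.

Lemma branch_smooth : smooth_on U f.
Proof.
move=> n x; apply: smooth_chain_derivable => //.
by have [] := branch_resolvent_smooth n.+1.
Qed.

End solution_branch.

End quadratic_branch.

Theorem quadratic_branch (R : realType) (V : completeNormedModType R)
    (B : V -> V -> V) (A : V -> V) (b : V) (beta alpha : R) :
  (forall u v, B u v = B v u) ->
  (forall u v w, B u (v + w) = B u v + B u w) ->
  (forall u (a : R) v, B u (a *: v) = a *: B u v) ->
  0 < beta -> (forall u v, `|B u v| <= beta * `|u| * `|v|) ->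
  (forall u v, A (u + v) = A u + A v) ->
  (forall (a : R) u, A (a *: u) = a *: A u) ->
  0 < alpha -> (forall u, `|A u| <= alpha * `|u|) ->
  exists delta r : R, [/\ 0 < delta, 0 < r,
    forall e, - delta < e < delta ->
      exists! u, `|u| <= r /\ u = B u u + e *: A u + e *: b
    & exists phi : R -> V,
      (forall e, - delta < e < delta ->
        `|phi e| <= r /\ phi e = B (phi e) (phi e) + e *: A (phi e) + e *: b) /\
      smooth_on `]- delta, delta[ phi].
Proof.
move=> BC BD BZ beta0 B_le AD AZ alpha0 A_le.
(* For [g] in the ball of radius [2 * r] and small [e], the operators [B g] and
   [e *: A] each have norm at most 1/4, and [e *: b] has norm at most [r / 2]. *)
pose r := (8 * beta)^-1; pose delta := Num.min (4 * alpha)^-1 (r / (2 * (`|b| + 1))).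
have b1 : 0 < `|b| + 1 by rewrite ltr_wpDl.
have r0 : 0 < r by rewrite invr_gt0 mulr_gt0.
have delta0 : 0 < delta by rewrite lt_min invr_gt0 divr_gt0 ?mulr_gt0.
have br : 8 * beta * r <= 1 by rewrite mulfV// gt_eqF// mulr_gt0.
have ad : 4 * alpha * delta <= 1.
  by rewrite mulrC -ler_pdivlMr ?mulr_gt0// mul1r ge_min lexx.
have bd : 2 * delta * `|b| <= r.
  have : delta * (2 * (`|b| + 1)) <= r.
    by rewrite -ler_pdivlMr ?mulr_gt0// ge_min lexx orbT.
  by move: delta0; lra.
have ed e : - delta < e < delta -> `|e| <= delta.
  by move=> /andP[? ?]; rewrite ler_norml !ltW.
have ex := small_solution BC BD BZ beta0 B_le AD AZ A_le r0 br ad bd.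
exists delta, r; split=> // [e /ed e_le|].
  have [u ur uE] := ex e e_le; exists u; split=> // v [vr vE].
  exact: (small_solution_unique BC BD BZ beta0 B_le AD AZ A_le br ad e_le ur vr uE vE).
pose phi e := get [set u | `|u| <= r /\ u = B u u + e *: A u + e *: b].
have phiP e : `|e| <= delta ->
    `|phi e| <= r /\ phi e = B (phi e) (phi e) + e *: A (phi e) + e *: b.
  move=> e_le; have [u ur uE] := ex e e_le.
  exact: (@getPex _ [set u | `|u| <= r /\ u = B u u + e *: A u + e *: b]
    (ex_intro _ u (conj ur uE))).
exists phi; split; first by move=> e /ed /phiP.
have phiU x : `]- delta, delta[ x ->
    `|phi x| <= r /\ phi x = B (phi x) (phi x) + x *: A (phi x) + x *: b.
  by rewrite /= in_itv/= => /ed /phiP.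
exact: (branch_smooth BC BD BZ beta0 B_le AD AZ alpha0 A_le br ad
  (fun x Ux => (phiU x Ux).1) (fun x Ux => (phiU x Ux).2)).
Qed.

(** * Antiderivatives and comparison on the real line *)

Section real_analysis.
Context {R : realType}.
Local Notation mu := (@lebesgue_measure R).

Lemma continuous_integrable_itv (F : R -> R) (a b : R) : continuous F ->
  mu.-integrable `[a, b] (EFin \o F).
Proof.
move=> cF; apply: continuous_compact_integrable; first exact: segment_compact.
exact: continuous_subspaceT.
Qed.

Lemma Rintegral_lower_bound_change (F : R -> R) (a b x : R) : continuous F ->
  a <= b -> b <= 0 -> b <= x ->
  \int[mu]_(t in `[a, x]) F t - \int[mu]_(t in `[a, 0]) F t =
  \int[mu]_(t in `[b, x]) F t - \int[mu]_(t in `[b, 0]) F t.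
Proof.
move=> cF ab b0 bx.
have E y : b <= y -> \int[mu]_(t in `[a, y]) F t =
    \int[mu]_(t in `[a, b]) F t + \int[mu]_(t in `[b, y]) F t.
  move=> b_y; apply/eqP; rewrite addrC -subr_eq; apply/eqP.
  rewrite Rintegral_itvB ?bnd_simp//; last exact: continuous_integrable_itv.
  apply: Rintegral_itv_obnd_cbnd.
  apply: integrableS (continuous_integrable_itv b y cF) => //.
  exact: subset_itv_oc_cc.
by rewrite (E x)// (E 0)// opprD addrACA subrr add0r.
Qed.

(** For [x < 0] an integral from [0] to [x] is not an integral over an
    interval of the form [0, x]. Integrating from a point to the left of both
    [0] and [x], and subtracting, avoids signs; by
    [Rintegral_lower_bound_change] the choice of this point is immaterial, so
    near a given [x] it can be fixed. *)
Lemma continuous_antiderivative (F : R -> R) : continuous F ->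
  exists P : R -> R, forall x : R, is_derive x (1 : R) P (F x).
Proof.
move=> cF.
exists (fun x => \int[mu]_(t in `[- (`|x| + 1), x]) F t -
                 \int[mu]_(t in `[- (`|x| + 1), 0]) F t) => x.
pose a := - (`|x| + 2).
have ax : a < x by rewrite /a ltrNl; have := ler_norm (- x); rewrite normrN; lra.
have x1 : x < x + 1 by rewrite ltrDl.
have [dI IE] := continuous_FTC1_closed x1
  (continuous_integrable_itv a (x + 1) cF) ax (cF x).
pose I := fun y => \int[mu]_(t in `[a, y]) F t.
apply: (@near_eq_is_derive _ _ _
  (I - cst (\int[mu]_(t in `[a, 0]) F t))).
  near=> y.
  have xy : `|x - y| < 1 by near: y; exact: nbhsx_ballx.
  have := ler_norm y; have := ler_norm (- y); rewrite normrN => h1 h2.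
  have := ler_distD x y 0; rewrite !subr0 distrC => h3.
  by apply: Rintegral_lower_bound_change => //; rewrite /a; lra.
rewrite -[F x]subr0; apply: is_deriveB.
by split; [exact: dI|rewrite -derive1E; exact: IE].
Unshelve. all: by end_near. Qed.

Lemma derive_ge0_nondecreasing (f df : R -> R) :
  (forall x : R, is_derive x (1 : R) f (df x)) -> (forall x, 0 <= df x) ->
  forall x y, x <= y -> f x <= f y.
Proof.
move=> fd f0 x y xy.
have [|z _ zE] := @MVT_segment R f df x y xy (fun z _ => fd z).
  apply: continuous_subspaceT => z.
  by apply/differentiable_continuous/derivable1_diffP; have [] := fd z.
by rewrite -subr_ge0 zE mulr_ge0// subr_ge0.
Qed.

(** [M Q - P] and [M Q + P] are both nondecreasing. *)
Lemma derive_le_comparison (P Q dP dQ : R -> R) (M : R) :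
  (forall x : R, is_derive x (1 : R) P (dP x)) -> (forall x : R, is_derive x (1 : R) Q (dQ x)) ->
  Q 0 = 0 -> 0 <= M -> (forall x, `|dP x| <= M * dQ x) ->
  forall x, `|P x - P 0| <= M * `|Q x|.
Proof.
move=> hP hQ Q0 M0 le x.
have d1 y : is_derive y (1 : R) (M \*: Q - P) (M * dQ y - dP y) by exact: is_deriveB.
have d2 y : is_derive y (1 : R) (M \*: Q + P) (M * dQ y + dP y) by exact: is_deriveD.
have m1 := derive_ge0_nondecreasing d1; have m2 := derive_ge0_nondecreasing d2.
have {}m1 : forall x y, x <= y -> M * Q x - P x <= M * Q y - P y.
  by apply: m1 => y; have := le y; rewrite ler_norml => /andP[]; lra.
have {}m2 : forall x y, x <= y -> M * Q x + P x <= M * Q y + P y.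
  by apply: m2 => y; have := le y; rewrite ler_norml => /andP[]; lra.
rewrite -{1}(ger0_norm M0) -normrM.
have [x0|x0] := leP 0 x.
  have := m1 0 x x0; have := m2 0 x x0; rewrite Q0 mulr0 => h1 h2.
  rewrite [leRHS]ger0_norm ?ler_norml; last by lra.
  by apply/andP; split; lra.
have := m1 x 0 (ltW x0); have := m2 x 0 (ltW x0); rewrite Q0 mulr0 => h1 h2.
rewrite [leRHS]ler0_norm ?ler_norml; last by lra.
by apply/andP; split; lra.
Qed.

(** If the integral vanished, [f] would vanish almost everywhere on ]0, 1[,
    which has measure 1. *)
Lemma Rintegral_continuous_gt0 (f : R -> R) : continuous f ->
  mu.-integrable setT (EFin \o f) -> (forall x, 0 <= f x) ->
  (forall x, x != 0 -> 0 < f x) -> 0 < \int[mu]_x f x.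
Proof.
move=> cf fi f0 fpos; rewrite lt_neqAle Rintegral_ge0// andbT eq_sym.
apply/eqP => I0.
have mf : measurable_fun setT (EFin \o f).
  by apply/measurable_EFinP; exact: continuous_measurable_fun.
have /(ae_eq_integral_abs mu measurableT mf) [N [mN N0 sN]] :
    (\int[mu]_x `|(EFin \o f) x| = 0)%E.
  under eq_integral do rewrite gee0_abs ?lee_fin//.
  have : (fine (\int[mu]_x (EFin \o f) x))%:E = 0%:E by congr EFin.
  by rewrite fineK// integrable_fin_num.
have sub : `]0, 1[ `<=` N.
  move=> x /=; rewrite in_itv/= => /andP[x0 _]; apply: sN => /= /(_ Logic.I)[] fx0.
  by have := fpos x (lt0r_neq0 x0); rewrite fx0 ltxx.
have : (mu `]0%R, 1%R[ <= mu N)%E by apply: le_measure; rewrite ?inE.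
by rewrite N0 lebesgue_measure_itv/= lte_fin ltr01 oppr0 adde0 lee_fin ler10.
Qed.

End real_analysis.

(** * The linearized operator *)

Section linearized_operator.
Context {R : realType}.
Local Notation mu := (@lebesgue_measure R).

Lemma derivable_continuous (u : R -> R) :
  (forall x, derivable u x 1) -> continuous u.
Proof. by move=> du x; exact/differentiable_continuous/derivable1_diffP. Qed.

Lemma bounded_fun_of_le (u : R -> R) (M : R) : (forall x, `|u x| <= M) -> bounded_fun u.
Proof.
move=> uM; exists M; split=> [|N MN x _]; first exact: num_real.
exact: le_trans (uM x) (ltW MN).
Qed.

Lemma CbM (u v : R -> R) : Cb u -> Cb v -> Cb (fun x => u x * v x).
Proof.
move=> [cu bu] [cv bv]; split.
  by move=> x; apply: continuousM; [exact: cu|exact: cv].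
apply: (@bounded_fun_of_le _ (Linfty_norm u * Linfty_norm v)) => x.
by rewrite normrM ler_pM//; exact: Linfty_norm_ub.
Qed.

Lemma CbZ (a : R) (f : R -> R) : Cb f -> Cb (a *: f).
Proof. by move=> Cf; rewrite -[a *: f]addr0; exact: CbZD Cf Cb0. Qed.

Lemma CbD (f g : R -> R) : Cb f -> Cb g -> Cb (f + g).
Proof. by move=> Cf Cg; rewrite -[f]scale1r; exact: CbZD. Qed.

Lemma cosh_ge1 (x : R) : 1 <= cosh x.
Proof.
rewrite -(@ler_pXn2r _ 2) ?nnegrE ?ler01 ?(ltW (cosh_gt0 _))// expr1n.
by have := sqr_cosh_sinh x; have := sqr_ge0 (sinh x); lra.
Qed.

Lemma sinh_neq0 (x : R) : x != 0 -> sinh x != 0.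
Proof.
apply: contra_neq => /eqP; rewrite mulf_eq0 invr_eq0 pnatr_eq0 orbF subr_eq0.
by move=> /eqP/expR_inj; lra.
Qed.

Section parameter.
Context (c : R).
Hypothesis c0 : 0 < c.
Local Notation k := (c / 2).

(** A negative multiple of [hc c]; it spans the solutions of
    [phi' + tauc * phi = 0]. *)
Definition sech2 (x : R) : R := sech (k * x) ^+ 2.

Lemma sech2_gt0 x : 0 < sech2 x.
Proof. by rewrite exprn_gt0// invr_gt0 cosh_gt0. Qed.

Lemma sech2_le1 x : sech2 x <= 1.
Proof.
rewrite exprn_ile1//; first by rewrite invr_ge0 ltW// cosh_gt0.
by rewrite invf_le1 ?cosh_gt0// cosh_ge1.
Qed.

Lemma sech2_cosh2 x : sech2 x * cosh (k * x) ^+ 2 = 1.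
Proof. by rewrite /sech2 /sech -exprMn mulVf ?expr1n// cosh_neq0. Qed.

Lemma is_derive_sech2 x :
  is_derive x (1 : R) sech2 (- (tauc c x * sech2 x)).
Proof.
have ds := is_derive_sechM k x.
rewrite {2}/sech2 taucE; have -> : sech2 = (fun y => sech (k * y)) ^+ 2 by [].
by apply: is_derive_eq; rewrite /GRing.scale/=; field.
Qed.

Lemma is_derive_cosh2 x : is_derive x (1 : R) (fun y => cosh (k * y) ^+ 2)
  (tauc c x * cosh (k * x) ^+ 2).
Proof.
have ds := is_derive_coshM k x.
have -> : (fun y => cosh (k * y) ^+ 2) = (fun y => cosh (k * y)) ^+ 2 :> (R -> R) by [].
apply: is_derive_eq; rewrite taucE /GRing.scale/= /tanh.
by field; exact: cosh_neq0.
Qed.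

Lemma normr_tauc_le x : `|tauc c x| <= c.
Proof.
rewrite taucE normrM (gtr0_norm c0) -[leRHS]mulr1 ler_wpM2l ?normr_tanh_le1//.
exact: ltW.
Qed.

Lemma continuous_tauc : continuous (tauc c).
Proof.
apply: derivable_continuous => x.
have -> : tauc c = c \*: (fun y => tanh (k * y)).
  by apply/funext => y; rewrite taucE.
by apply: derivableZ; have [] := is_derive_tanhM k x.
Qed.

Lemma Cb_tauc : Cb (tauc c).
Proof. split; [exact: continuous_tauc|exact: bounded_fun_of_le normr_tauc_le]. Qed.

Lemma Cb1_of_ode (u f : R -> R) :
  (forall x : R, is_derive x (1 : R) u (f x - tauc c x * u x)) ->
  Cb f -> bounded_fun u -> Cb1 u.
Proof.
move=> du Cf bu.
have dvu x : derivable u x 1 by have [] := du x.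
have Cu : Cb u by split; [exact: derivable_continuous|exact: bu].
split; [exact: dvu|exact: Cu|].
have -> : u^`() = f + (-1) *: (fun x => tauc c x * u x).
  apply/funext => x; have d := du x.
  rewrite derive1E derive_val.
  by rewrite [RHS](_ : _ = f x + (-1) * (tauc c x * u x))// mulN1r.
by apply: CbD => //; apply: CbZ; apply: CbM => //; exact: Cb_tauc.
Qed.

Lemma Cb1_sech2 : Cb1 sech2.
Proof.
apply: (@Cb1_of_ode _ (cst 0)).
- by move=> x; rewrite sub0r; exact: is_derive_sech2.
- exact: Cb0.
- apply: (@bounded_fun_of_le _ 1) => x; rewrite ger0_norm ?sech2_le1//.
  by rewrite ltW// sech2_gt0.
Qed.

(** As [sech2] is a multiple of [hc], its pairing is a nonzero multiple of the
    squared L^2 norm of the derivative of [hc]. This is what singles out one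
    solution of [phi' + tauc * phi = f] in [X c]. *)
Lemma orth_sech2_neq0 : orth c sech2 != 0.
Proof.
have sE x : sech2^`() x = - (tauc c x * sech2 x).
  by have d := is_derive_sech2 x; rewrite derive1E derive_val.
have hE x : (hc c)^`() x = c ^+ 2 / 2 * (tauc c x * sech2 x).
  have d := is_derive_hc c x; rewrite derive1E derive_val taucE /sech2.
  by field.
have [sd [cs bs] [cs' bs']] := Cb1_sech2.
have si := integrable_orth c Cb1_sech2.
rewrite -oppr_eq0 -mulN1r /orth -RintegralZl//; apply/lt0r_neq0.
have fE x : -1 * (sech2^`() x * (hc c)^`() x) =
    c ^+ 2 / 2 * (tauc c x * sech2 x) ^+ 2 by rewrite sE hE; ring.
apply: Rintegral_continuous_gt0.
- under eq_fun do rewrite fE.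
  have := CbZ (c ^+ 2 / 2) (CbM (CbM Cb_tauc (conj cs bs)) (CbM Cb_tauc (conj cs bs))).
  by case.
- by have := integrableZl measurableT (-1) si; apply: eq_integrable.
- by move=> x; rewrite fE mulr_ge0 ?sqr_ge0// divr_ge0// sqr_ge0.
- move=> x x0; rewrite fE mulr_gt0//; first by rewrite divr_gt0 ?exprn_gt0.
  have t0 : tanh (k * x) != 0.
    have kx0 : k * x != 0 by rewrite mulf_neq0// gt_eqF// divr_gt0.
    by rewrite mulf_neq0 ?invr_neq0 ?cosh_neq0 ?sinh_neq0.
  rewrite exprn_even_gt0//= mulf_neq0 ?(gt_eqF (sech2_gt0 _))//.
  by rewrite taucE mulf_neq0// gt_eqF.
Qed.

Lemma Cb1_orth_le (u : R -> R) (M : R) : Cb1 u -> (forall x, `|u^`() x| <= M) ->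
  `|orth c u| <= M * \int[mu]_x `|(hc c)^`() x|.
Proof.
move=> Cu uM.
have hi := integrable_derive1_hc c.
have hi' : mu.-integrable setT (EFin \o (fun x => `|(hc c)^`() x|)).
  by have := integrable_abse hi; apply: eq_integrable.
have ui := integrable_orth c Cu.
apply: le_trans (le_normr_Rintegral _ ui) _ => //.
rewrite -RintegralZl//; apply: le_Rintegral => //.
- by have := integrable_abse ui; apply: eq_integrable.
- by have := integrableZl measurableT M hi'; apply: eq_integrable.
- by move=> x _; rewrite normrM ler_wpM2r.
Qed.

(** Variation of constants: with the integrating factor [cosh ^ 2], the
    solution is [sech2] times an antiderivative of [cosh ^ 2 * f]. That
    antiderivative grows no faster than [sinh * cosh], whose derivative
    dominates [cosh ^ 2], and [sech2 * sinh * cosh = tanh] is bounded. *)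
Lemma linear_ode_bounded_solution : exists2 K, 0 < K & forall f, Cb f ->
  exists u : R -> R, [/\ forall x : R, is_derive x (1 : R) u (f x - tauc c x * u x),
    Cb1 u & forall x, `|u x| <= K * Linfty_norm f].
Proof.
exists k^-1; first by rewrite invr_gt0 divr_gt0.
move=> f Cf; have [cf bf] := Cf.
pose F x := cosh (k * x) ^+ 2 * f x.
have cF : continuous F.
  move=> x; apply: (@continuousM _ _ (fun x => cosh (k * x) ^+ 2) f); last exact: cf.
  apply: derivable_continuous => y.
  by have [] := is_derive_cosh2 y.
have [P dP] := continuous_antiderivative cF.
pose Q x := k^-1 * (sinh (k * x) * cosh (k * x)).
pose u x := sech2 x * (P x - P 0).
have k0 : 0 < k by rewrite divr_gt0.
have dQ x : is_derive x (1 : R) Q (cosh (k * x) ^+ 2 + sinh (k * x) ^+ 2).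
  have dc := is_derive_coshM k x; have ds := is_derive_sinhM k x.
  have -> : Q = k^-1 \*: ((fun x => sinh (k * x)) * (fun x => cosh (k * x))) by [].
  by apply: is_derive_eq; rewrite /GRing.scale/=; field; rewrite gt_eqF.
have f0 := Linfty_norm_ge0 bf.
have Q0 : Q 0 = 0 by rewrite /Q mulr0 /sinh oppr0 subrr !mul0r mulr0.
have leP : forall x, `|P x - P 0| <= Linfty_norm f * `|Q x|.
  apply: (derive_le_comparison dP dQ) => // x.
  rewrite /F normrM mulrC ler_pM//; first exact: Linfty_norm_ub.
  by rewrite ger0_norm ?sqr_ge0// lerDl sqr_ge0.
have leQ x : sech2 x * `|Q x| <= k^-1.
  rewrite /Q normrM gtr0_norm ?invr_gt0// mulrCA -[leRHS]mulr1 ler_pM2l ?invr_gt0//.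
  rewrite normrM (gtr0_norm (cosh_gt0 _)).
  rewrite -[leRHS](sech2_cosh2 x) ler_pM2l ?sech2_gt0// expr2 ler_pM2r ?cosh_gt0//.
  have := normr_tanh_le1 (k * x); rewrite /tanh normrM normfV (gtr0_norm (cosh_gt0 _)).
  by rewrite ler_pdivrMr ?cosh_gt0// mul1r.
have le_u x : `|u x| <= k^-1 * Linfty_norm f.
  rewrite /u normrM (gtr0_norm (sech2_gt0 x)).
  apply: le_trans (ler_wpM2l (ltW (sech2_gt0 x)) (leP x)) _.
  by rewrite mulrCA mulrC ler_wpM2r.
have du x : is_derive x (1 : R) u (f x - tauc c x * u x).
  have d1 := is_derive_sech2 x.
  have d2 : is_derive x (1 : R) (P - cst (P 0)) (F x).
    by rewrite -[F x]subr0; apply: is_deriveB; exact: dP.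
  have -> : f x - tauc c x * u x =
      sech2 x *: F x + (P x - P 0) *: (- (tauc c x * sech2 x)).
    rewrite /GRing.scale/= /F [sech2 x * (_ * f x)]mulrA sech2_cosh2 /u; ring.
  have -> : u = sech2 * (P - cst (P 0)) by [].
  apply: is_deriveM.
exists u; split=> //; apply: (@Cb1_of_ode _ f) => //; exact: bounded_fun_of_le le_u.
Qed.

Definition linearization (phi : R -> R) (x : R) : R := tauc c x * phi x + phi^`() x.

(** Any multiple of [sech2] may be added to a bounded solution of the
    differential equation; the right multiple makes the pairing vanish. *)
Lemma linearization_solvable : exists2 K, 0 < K & forall f, Cb f ->
  exists phi : X c, linearization phi = f /\ `|phi| <= K * Linfty_norm f.
Proof.
have [K K0 solve] := linear_ode_bounded_solution.
pose J := \int[mu]_x `|(hc c)^`() x|.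
have J0 : 0 <= J by exact: Rintegral_ge0.
pose o := `|orth c sech2|.
have o0 : 0 < o by rewrite normr_gt0 orth_sech2_neq0.
pose K1 := K + (1 + c * K) * J / o.
have K1_ge0 : 0 < K1.
  by rewrite ltr_pwDl// divr_ge0 ?(ltW o0)// mulr_ge0// addr_ge0// mulr_ge0// ltW.
exists (K1 + (1 + c * K1)); first by rewrite addr_gt0// addr_gt0// mulr_gt0.
move=> f Cf; have [u [du Cu le_u]] := solve f Cf.
have f0 := Linfty_norm_ge0 Cf.2.
(* [K1 * Linfty_norm f] bounds [a *: sech2 + u], and the derivative is bounded
   through the differential equation, whence [1 + c * K1]. *)
pose a := - (orth c u / orth c sech2).
have Cphi : Cb1 (a *: sech2 + u) by apply: Cb1ZD => //; exact: Cb1_sech2.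
have ophi : orth c (a *: sech2 + u) = 0.
  by rewrite orthZD//; [rewrite /a mulNr divfK ?orth_sech2_neq0// addNr|exact: Cb1_sech2].
have phiP : (a *: sech2 + u) \in in_X c by apply/in_XP.
exists (MkX phiP); rewrite X_normE/=.
have dphi x : is_derive x (1 : R) (a *: sech2 + u) (f x - tauc c x * (a * sech2 x + u x)).
  have d1 := is_derive_sech2 x; have d2 := du x.
  by apply: is_derive_eq; rewrite /GRing.scale/=; ring.
have phi'E x : (a *: sech2 + u)^`() x = f x - tauc c x * (a * sech2 x + u x).
  by have d := dphi x; rewrite derive1E derive_val.
split; first by apply/funext => x; rewrite /linearization phi'E addrC subrK.
have u'_le x : `|u^`() x| <= (1 + c * K) * Linfty_norm f.
  have d := du x; rewrite derive1E derive_val.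
  rewrite [leRHS]mulrDl mul1r (le_trans (ler_normB _ _))// lerD//.
    by apply: Linfty_norm_ub; case: Cf.
  by rewrite normrM -mulrA ler_pM// normr_tauc_le.
have a_le : `|a| <= (1 + c * K) * J / o * Linfty_norm f.
  have -> : `|a| = `|orth c u| / o by rewrite normrN normf_div.
  by rewrite mulrAC ler_pM2r ?invr_gt0// mulrAC; exact: Cb1_orth_le.
have phi_le x : `|a * sech2 x + u x| <= K1 * Linfty_norm f.
  apply: le_trans (ler_normD _ _) _; rewrite /K1 mulrDl addrC lerD//.
  rewrite normrM (le_trans _ a_le)// ler_piMr//.
  by rewrite gtr0_norm ?sech2_gt0 ?sech2_le1.
rewrite /Cb1_norm mulrDl; apply: lerD; apply: Linfty_norm_le => x.
  exact: phi_le.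
rewrite phi'E [leRHS]mulrDl mul1r (le_trans (ler_normB _ _))// lerD//.
  by apply: Linfty_norm_ub; case: Cf.
by rewrite normrM -mulrA ler_pM// normr_tauc_le.
Qed.

(** For a solution of the homogeneous equation [cosh ^ 2 * phi] is constant,
    so [phi] is a multiple of [sech2] and its pairing vanishes only if [phi]
    does. *)
Lemma linearization_inj (phi : X c) : linearization phi = cst 0 -> phi = 0.
Proof.
move=> L0; have /in_XP[[dphi _ _] ophi] := valP phi.
have phi'E x : phi^`() x = - (tauc c x * phi x).
  by have /(congr1 (@^~ x)) := L0; rewrite /linearization/= => /eqP; rewrite addrC addr_eq0 => /eqP.
pose w := (fun y => cosh (k * y) ^+ 2) * (phi : R -> R).
have dw (x : R) : is_derive x (1 : R) w 0.
  have d1 := is_derive_cosh2 x.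
  have d2 : is_derive x (1 : R) (phi : R -> R) (- (tauc c x * phi x)).
    by rewrite -phi'E derive1E; exact: derivableP.
  by apply: is_derive_eq; rewrite /GRing.scale/=; ring.
have phiE : (phi : R -> R) = (w 0) *: sech2.
  apply/funext => x; rewrite [RHS](_ : _ = w 0 * sech2 x)//.
  rewrite -(is_derive_0_is_cst x 0 dw) (_ : w x = cosh (k * x) ^+ 2 * phi x)//.
  by rewrite mulrC mulrA sech2_cosh2 mul1r.
have w0 : w 0 = 0.
  have : w 0 * orth c sech2 = 0.
    rewrite -[RHS]ophi/= phiE -[in RHS](addr0 (_ *: sech2)) orthZD;
      [|exact: Cb1_sech2|exact: Cb1_0].
    by have [/in_XP[_ ->] _] := in_X_submod_closed c; rewrite addr0.
  by move/eqP; rewrite mulf_eq0 (negbTE orth_sech2_neq0) orbF => /eqP.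
by apply/val_inj; rewrite /= phiE w0 scale0r.
Qed.

End parameter.
End linearized_operator.

(** * Completeness of the solution space *)

Section completeness.
Context {R : realType} (c : R).
Hypothesis c0 : 0 < c.

Lemma Cb_linearization (u : R -> R) : Cb1 u -> Cb (linearization c u).
Proof.
by move=> [_ Cu Cu']; exact: (CbD (CbM (Cb_tauc c0) Cu) Cu').
Qed.

Lemma linearizationZD (a : R) (u v : R -> R) : Cb1 u -> Cb1 v ->
  linearization c (a *: u + v) = a *: linearization c u + linearization c v.
Proof.
move=> [du _ _] [dv _ _]; apply/funext => x; rewrite /linearization derive1ZD//.
by rewrite !fctE /GRing.scale/=; ring.
Qed.

Lemma linearizationB (p q : X c) :
  linearization c (p - q) = linearization c p - linearization c q.
Proof.
rewrite -[p - q]addrC -scaleN1r X_funD X_funZ linearizationZD ?scaleN1r 1?addrC//; exact: X_Cb1.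
Qed.

Lemma linearization_injective (p q : X c) :
  linearization c p = linearization c q -> p = q.
Proof.
move=> pq; apply/eqP; rewrite -subr_eq0; apply/eqP.
by apply: linearization_inj => //; rewrite linearizationB pq subrr.
Qed.

Lemma linearization_ub (p : X c) x : `|linearization c p x| <= (1 + c) * `|p|.
Proof.
have [_ [_ bp] [_ bp']] := X_Cb1 p.
rewrite X_normE /Cb1_norm.
have h1 := Linfty_norm_ub x bp; have h2 := Linfty_norm_ub x bp'.
have h3 : `|tauc c x * p x| <= c * Linfty_norm p.
  by rewrite normrM ler_pM// normr_tauc_le.
apply: le_trans (ler_normD _ _) _.
have := Linfty_norm_ge0 bp; have : 0 <= c * Linfty_norm (p : R -> R)^`().
  by rewrite mulr_ge0 ?(ltW c0)// Linfty_norm_ge0.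
lra.
Qed.

Lemma linearization_bounded_below : exists2 K, 0 < K & forall p : X c,
  `|p| <= K * Linfty_norm (linearization c p).
Proof.
have [K K0 H] := linearization_solvable c0; exists K => // p.
have [q [qp qK]] := H _ (Cb_linearization (X_Cb1 p)).
by rewrite (linearization_injective qp) in qK.
Qed.

(** The images by [linearization] of a Cauchy filter converge uniformly to a
    bounded continuous function, and [linearization] has a bounded inverse.
    This spares the study of limits of derivatives and of the orthogonality
    condition. *)
Lemma X_complete (F : set_system (X c)) : ProperFilter F -> cauchy F -> cvg F.
Proof.
move=> PF cF.
have c1 : 0 < 1 + c by rewrite addr_gt0.
have /cauchyP near_center := cF.
have L_near (p q : X c) e x : ball p e q ->
    `|linearization c p x - linearization c q x| <= (1 + c) * e.
  rewrite -ball_normE /= => pq.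
  have := linearization_ub (p - q) x; rewrite linearizationB => /le_trans; apply.
  by rewrite ler_wpM2l// ltW.
have cvgx x : cvg (linearization c (p : X c) x @[p --> F]).
  apply: cauchy_cvg; apply: cauchy_exP => e e0.
  have e1 : 0 < e / (2 * (1 + c)) by rewrite divr_gt0// mulr_gt0.
  have [p Fp] := near_center _ e1.
  exists (linearization c p x); move: Fp; rewrite nbhs_simpl/=; apply: filterS => q pq.
  have h := L_near _ _ _ x pq.
  rewrite /= -ball_normE /=; apply: le_lt_trans h _.
  have -> : (1 + c) * (e / (2 * (1 + c))) = e / 2 by field; rewrite gt_eqF.
  by rewrite ltr_pdivrMr// ltr_pMr// ltr1n.
(* The pointwise limit is a uniform one by [f_near], which does not depend on
   the point. *)
pose f x := lim (linearization c (p : X c) x @[p --> F]).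
have f_near (p : X c) e x : F (ball p e) -> `|linearization c p x - f x| <= (1 + c) * e.
  move=> Fp; apply/ler_addgt0Pr => d d0.
  have /cvgrPdist_le/(_ d d0) fd := cvgx x.
  have [q [pq fq]] := filter_ex (filterI Fp fd).
  apply: le_trans (ler_distD (linearization c q x) _ _) _.
  by apply: lerD; [exact: L_near|rewrite distrC].
have Cf : Cb f.
  split.
    move=> x; apply/cvgrPdist_le => e e0.
    have e1 : 0 < e / (3 * (1 + c)) by rewrite divr_gt0// mulr_gt0.
    have [p Fp] := near_center _ e1.
    have E : (1 + c) * (e / (3 * (1 + c))) = e / 3 by field; rewrite gt_eqF.
    have [cL _] := Cb_linearization (X_Cb1 p).
    have e3 : 0 < e / 3 by rewrite divr_gt0.
    have /cvgrPdist_le/(_ _ e3) := cL x; apply: filterS => y hy.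
    have -> : e = e / 3 + (e / 3 + e / 3) by lra.
    apply: le_trans (ler_distD (linearization c p x) _ _) _; apply: lerD.
      by rewrite distrC -E f_near.
    apply: le_trans (ler_distD (linearization c p y) _ _) _; apply: lerD => //.
    by rewrite -E f_near.
  have [p Fp] := near_center 1 ltr01.
  apply: (@bounded_fun_of_le _ _ ((1 + c) * `|p| + (1 + c))) => x.
  have := f_near p 1 x Fp; have := linearization_ub p x.
  have := ler_normB (linearization c p x) (linearization c p x - f x).
  by rewrite subKr mulr1; lra.
have [K K0 HK] := linearization_bounded_below.
have [_ _ /(_ f Cf)[phi [phiE _]]] := linearization_solvable c0.
apply/cvg_ex; exists phi; apply/cvgrPdist_le => e e0.
have K1 : 0 < 1 + K * (1 + c) by rewrite addr_gt0// mulr_gt0.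
have e1 : 0 < e / (1 + K * (1 + c)) by rewrite divr_gt0.
have [p Fp] := near_center _ e1.
apply: filterS (Fp) => q; rewrite -ball_normE /= => pq.
apply: le_trans (ler_distD p _ _) _.
have phip : `|phi - p| <= K * ((1 + c) * (e / (1 + K * (1 + c)))).
  apply: le_trans (HK _) _; rewrite ler_wpM2l ?(ltW K0)//.
  apply: Linfty_norm_le => x; rewrite linearizationB phiE distrC.
  exact: f_near.
have -> : e = K * ((1 + c) * (e / (1 + K * (1 + c)))) + e / (1 + K * (1 + c)).
  by field; rewrite gt_eqF.
by rewrite lerD// ltW.
Qed.

End completeness.

(** * Convolution with integrable kernels *)

Section convolution_with_kernel.
Context {R : realType}.
Local Notation mu := (@lebesgue_measure R).

Lemma continuous_reflection (v : R -> R) (x : R) :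
  continuous v -> continuous (fun y => v (x - y)).
Proof.
move=> cv y; apply: (@continuous_comp R R R (fun z : R => x - z) v); last exact: cv.
by apply: cvgB; [exact: cvg_cst|exact: cvg_id].
Qed.

Lemma continuous_translation (v : R -> R) (a : R) :
  continuous v -> continuous (fun y => v (y - a)).
Proof.
move=> cv y; apply: (@continuous_comp R R R (fun z : R => z - a) v); last exact: cv.
by apply: cvgB; [exact: cvg_id|exact: cvg_cst].
Qed.

Section kernel.
Context (D : set (measurableTypeR R)) (w : R -> R).
Hypothesis mD : measurable D.
Hypothesis w0 : forall y, D y -> 0 <= w y.
Hypothesis iw : mu.-integrable D (EFin \o w).

Lemma integrable_kernel (u : R -> R) x : Cb u ->
  mu.-integrable D (EFin \o (fun y => u (x - y) * w y)).
Proof.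
move=> [cu bu].
have -> : EFin \o (fun y => u (x - y) * w y) =
  ((EFin \o (fun y => u (x - y)%R)) \* (EFin \o w))%E by [].
apply: integrableMr => //.
  apply: measurable_funTS; apply: continuous_measurable_fun.
  exact: continuous_reflection.
exists (Linfty_norm u); split=> [|M uM y _]; first exact: num_real.
by rewrite /= (le_trans _ (ltW uM))//; exact: Linfty_norm_ub.
Qed.

Lemma kernel_le (u : R -> R) x : Cb u ->
  `|\int[mu]_(y in D) (u (x - y) * w y)| <=
    Linfty_norm u * \int[mu]_(y in D) w y.
Proof.
move=> Cu; have iu := integrable_kernel x Cu.
apply: le_trans (le_normr_Rintegral _ iu) _ => //.
rewrite -RintegralZl//; apply: le_Rintegral => //.
- by have := integrable_abse iu; apply: eq_integrable.
- by have := integrableZl mD (Linfty_norm u) iw; apply: eq_integrable.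
- move=> y Dy; rewrite normrM (ger0_norm (w0 Dy)) ler_wpM2r ?w0//.
  by apply: Linfty_norm_ub; case: Cu.
Qed.

(** Continuity is dominated convergence, with [Linfty_norm u * w] as a
    dominating function. *)
Lemma Cb_kernel (u : R -> R) : Cb u ->
  Cb (fun x => \int[mu]_(y in D) (u (x - y) * w y)).
Proof.
move=> Cu; split; last first.
  by apply: (@bounded_fun_of_le _ _ (Linfty_norm u * \int[mu]_(y in D) w y)) => x; exact: kernel_le.
move=> x.
apply: (@continuity_under_integral R _ _ mu (fun x y => u (x - y) * w y) D mD
  (x - 1) (x + 1) _ _ (fun y => Linfty_norm u * w y)).
- by move=> z _; exact: integrable_kernel.
- apply: aeW => y _ z _.
  apply: (@continuousM _ _ (fun z => u (z - y)) (cst (w y))); last exact: cvg_cst.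
  by apply: continuous_translation; case: Cu.
- by have := integrableZl mD (Linfty_norm u) iw; apply: eq_integrable.
- move=> z _; apply: aeW => y Dy; rewrite normrM (ger0_norm (w0 Dy)) ler_wpM2r ?w0//.
  by apply: Linfty_norm_ub; case: Cu.
- by apply/mem_set; rewrite /= in_itv/=; apply/andP; split; lra.
Qed.

Lemma kernelZD (a : R) (u v : R -> R) x : Cb u -> Cb v ->
  \int[mu]_(y in D) ((a *: u + v) (x - y) * w y) =
  a * \int[mu]_(y in D) (u (x - y) * w y) + \int[mu]_(y in D) (v (x - y) * w y).
Proof.
move=> Cu Cv; have iu := integrable_kernel x Cu; have iv := integrable_kernel x Cv.
rewrite -RintegralZl// -RintegralD//; last first.
  by have := integrableZl mD a iu; apply: eq_integrable.
by apply: eq_Rintegral => y _; rewrite mulrA -mulrDl.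
Qed.

End kernel.

Lemma integrable_exhaustion (F : (set (measurableTypeR R))^nat) (f : R -> R) (M : R) :
  nondecreasing_seq F -> (forall i, measurable (F i)) ->
  measurable_fun setT f -> (forall x, 0 <= f x) ->
  (forall i, (\int[mu]_(x in F i) (f x)%:E <= M%:E)%E) ->
  mu.-integrable (\bigcup_i F i) (EFin \o f).
Proof.
move=> ndF mF mf f0 FM; apply/integrableP; split.
  by apply/measurable_EFinP; exact: measurable_funTS.
under eq_integral do rewrite gee0_abs ?lee_fin//.
apply: (@le_lt_trans _ _ M%:E); last exact: ltry.
have mFf i : measurable_fun (F i) (EFin \o f).
  by apply/measurable_EFinP; exact: measurable_funTS.
have H := @ge0_nondecreasing_set_cvg_integral _ _ _ F (EFin \o f) mu ndF mF mFf
  (fun i x _ => f0 x).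
have <- := cvg_lim (@ereal_hausdorff R) H.
apply: lime_le; first by apply/cvg_ex; eexists; exact: H.
by near=> i; exact: FM.
Unshelve. all: by end_near. Qed.

Lemma is_derive_powR_pos (a x : R) : 0 < x ->
  is_derive x (1 : R) (fun y => y `^ a) (a * x `^ (a - 1)).
Proof. by move=> x0; exact: is_derive1_powR. Qed.


Lemma continuous_powR_pos (a x : R) : 0 < x -> {for x, continuous (fun y => y `^ a)}.
Proof.
move=> x0; apply/differentiable_continuous/derivable1_diffP.
by have [] := is_derive_powR_pos a x0.
Qed.

Lemma integral_powR (p a b : R) : p != 0 -> 0 < a -> a < b ->
  (\int[mu]_(y in `[a, b]) (y `^ (p - 1))%:E = (p^-1 * b `^ p)%:E - (p^-1 * a `^ p)%:E)%E.
Proof.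
move=> p0 a0 ab.
have dF (x : R) : 0 < x -> is_derive x (1 : R) (p^-1 \*: (fun y => y `^ p)) (x `^ (p - 1)).
  move=> x0; have d := is_derive_powR_pos p x0.
  by apply: is_derive_eq; rewrite /GRing.scale/= mulKf.
have cF (x : R) : 0 < x -> {for x, continuous (p^-1 \*: (fun y => y `^ p))}.
  by move=> x0; apply/differentiable_continuous/derivable1_diffP; have [] := dF _ x0.
rewrite (@continuous_FTC2 _ (fun y => y `^ (p - 1)) (p^-1 \*: (fun y => y `^ p)) a b ab)//.
- apply: continuous_in_subspaceT => x; rewrite inE/= in_itv/= => /andP[ax _].
  by apply: continuous_powR_pos; exact: lt_le_trans ax.
- split.
  + by move=> x; rewrite in_itv/= => /andP[ax _]; have [] := dF x (lt_trans a0 ax).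
  + by apply: cvg_at_right_filter; exact: cF.
  + by apply: cvg_at_left_filter; apply: cF; exact: lt_trans ab.
- move=> x; rewrite in_itv/= => /andP[ax _].
  by have d := dF x (lt_trans a0 ax); rewrite derive1E derive_val.
Qed.

Lemma measurable_powR_inv (r : R) : measurable_fun setT (fun y : R => (y `^ r)^-1).
Proof. by under eq_fun do rewrite -powRN; exact: measurable_powR. Qed.

(** Near 0 the kernel is unbounded, hence the exhaustion by the intervals
    [1 / (i + 2), 1] on which the fundamental theorem of calculus gives the
    uniform bound 3/2. *)
Lemma integrable_powR_01 :
  mu.-integrable `[0, 1] (EFin \o (fun y : R => (y `^ (1 / 3))^-1)).
Proof.
pose f := fun y : R => (y `^ (1 / 3))^-1.
have f0 y : 0 <= f y by rewrite invr_ge0 powR_ge0.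
pose F i := `[(i.+2%:R)^-1, 1 : R]%classic.
have H : mu.-integrable (\bigcup_i F i) (EFin \o f).
  apply: (@integrable_exhaustion _ _ (3 / 2)) => //.
  - apply/nondecreasing_seqP => n; rewrite subsetEset => x; rewrite /F/= !in_itv/=.
    move=> /andP[nx ->]; rewrite andbT (le_trans _ nx)//.
    by rewrite lef_pV2 ?posrE ?ltr0Sn// ler_nat.
  - by move=> i; exact: measurable_itv.
  - exact: measurable_powR_inv.
  - move=> i; have -> : (fun x => (f x)%:E) = (fun y : R => (y `^ (2 / 3 - 1))%:E).
      by apply/funext => y; rewrite /f -powRN; congr (_ `^ _)%:E; field.
    have i1 : (i.+2%:R)^-1 < 1 :> R by rewrite invf_lt1 ?ltr0Sn// ltr1n.
    have p0 : (2 / 3 : R) != 0 by rewrite mulf_neq0 ?invr_eq0 ?pnatr_eq0.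
    have i0 : 0 < (i.+2%:R)^-1 :> R by rewrite invr_gt0 ltr0Sn.
    rewrite (integral_powR p0 i0 i1).
    rewrite powR1 invf_div mulr1 -EFinB lee_fin gerBl mulr_ge0 ?powR_ge0//.
have : mu.-integrable (`[0, 1] `\` [set 0]) (EFin \o f).
  apply: integrableS H; first by apply: bigcup_measurable => i _; exact: measurable_itv.
    by apply: measurableD => //; exact: measurable_set1.
  move=> x [] /=; rewrite in_itv/= => /andP[x0 x1] /eqP xn0.
  have {}x0 : 0 < x by rewrite lt_neqAle eq_sym xn0.
  exists (Num.bound x^-1) => //; rewrite /F/= in_itv/= x1 andbT.
  rewrite invf_ple ?posrE ?ltr0Sn// (le_trans (ltW (archi_boundP _))) ?invr_ge0 ?(ltW x0)//.
  by rewrite ler_nat -addn2 leq_addr.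
have mf : measurable_fun `[0 : R, 1] (EFin \o f).
  by apply/measurable_EFinP; apply: measurable_funTS; exact: measurable_powR_inv.
have HH := @negligible_integrable _ _ _ mu _ _ _ (measurable_set1 0) (measurable_itv _) mf
  (lebesgue_measure_set1 0).
by move=> /HH.2.
Qed.

Lemma cvg_powR_inv_pinfty (p : R) : 0 < p -> (y `^ p)^-1 @[y --> +oo] --> (0 : R).
Proof.
move=> p0; apply/cvgr0Pnorm_le => e e0; near=> y.
have y0 : 0 < y by near: y; exact: nbhs_pinfty_gt.
rewrite ger0_norm ?invr_ge0 ?powR_ge0// invf_ple ?posrE ?powR_gt0//.
have ey : (e^-1) `^ p^-1 <= y by near: y; exact: nbhs_pinfty_ge.
rewrite (le_trans _ (ge0_ler_powR (ltW p0) _ _ ey)) ?nnegrE ?powR_ge0 ?(ltW y0)//.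
by rewrite -powRrM mulVf ?gt_eqF// powRr1// invr_ge0 ltW.
Unshelve. all: by end_near. Qed.

Lemma integrable_powR_1y :
  mu.-integrable `[1, +oo[ (EFin \o (fun y : R => (y `^ (4 / 3))^-1)).
Proof.
have f0 (y : R) : 0 <= (y `^ (4 / 3))^-1 by rewrite invr_ge0 powR_ge0.
apply/integrableP; split.
  by apply/measurable_EFinP; apply: measurable_funTS; exact: measurable_powR_inv.
under eq_integral do rewrite gee0_abs ?lee_fin//.
pose F : R -> R := - 3 \*: (fun y : R => (y `^ (1 / 3))^-1).
have dF (x : R) : 0 < x -> is_derive x (1 : R) F ((x `^ (4 / 3))^-1).
  move=> x0; have d := is_derive_powR_pos (- (1 / 3)) x0.
  rewrite /F; under [X in _ \*: X]eq_fun do rewrite -powRN.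
  apply: is_derive_eq; rewrite /GRing.scale/= -powRN.
  have -> : - (4 / 3) = - (1 / 3) - 1 :> R by field.
  by move: (x `^ _) => z; field.
have cF (x : R) : 0 < x -> {for x, continuous F}.
  by move=> x0; apply/differentiable_continuous/derivable1_diffP; have [] := dF _ x0.
rewrite (@ge0_continuous_FTC2y _ _ F 1 0).
- by rewrite -EFinB ltry.
- by move=> x _; exact: f0.
- apply: continuous_in_subspaceT => x; rewrite inE/= in_itv/= andbT => x1.
  under eq_fun do rewrite -powRN.
  by apply: continuous_powR_pos; exact: lt_le_trans x1.
- rewrite -(mulr0 (-3)); apply: (@cvgM _ _ _ _ (cst (-3))); first exact: cvg_cst.
  by apply: cvg_powR_inv_pinfty; rewrite divr_gt0.
- by move=> x x1; have [] := dF x (lt_trans ltr01 x1).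
- by apply: cvg_at_right_filter; exact: cF.
- move=> x; rewrite in_itv/= andbT => x1.
  by have d := dF x (lt_trans ltr01 x1); rewrite derive1E derive_val.
Qed.

End convolution_with_kernel.

(** * The nonlocal operator *)

Section nonlocal_operator.
Context {R : realType}.
Local Notation mu := (@lebesgue_measure R).
Local Notation w13 := (fun y : R => (y `^ (1 / 3))^-1).
Local Notation w43 := (fun y : R => (y `^ (4 / 3))^-1).

Let w_ge0 (D : set R) (r : R) y : D y -> 0 <= (y `^ r)^-1.
Proof. by rewrite invr_ge0 powR_ge0. Qed.

Lemma Cb_gop (u : R -> R) : Cb1 u -> Cb (gop u).
Proof.
move=> [_ Cu Cu'].
have H1 := Cb_kernel (measurable_itv _) (@w_ge0 _ _) integrable_powR_01 Cu'.
have H2 := Cb_kernel (measurable_itv _) (@w_ge0 _ _) integrable_powR_1y Cu.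
have H3 : Cb (fun x => u (x - 1)).
  split; last by apply: (@bounded_fun_of_le _ _ (Linfty_norm u)) => x; apply: Linfty_norm_ub; case: Cu.
  by apply: continuous_translation; case: Cu.
have := CbD (CbD H1 H3) (CbZ (- (1 / 3)) H2).
by congr Cb; apply/funext => x; rewrite !fctE /GRing.scale/= mulNr.
Qed.

Lemma gopZD (a : R) (u v : R -> R) : Cb1 u -> Cb1 v ->
  gop (a *: u + v) = a *: gop u + gop v.
Proof.
move=> [du Cu Cu'] [dv Cv Cv']; apply/funext => x.
have H1 := kernelZD (measurable_itv _) integrable_powR_01 a x Cu' Cv'.
have H2 := kernelZD (measurable_itv _) integrable_powR_1y a x Cu Cv.
rewrite [RHS](_ : _ = a * gop u x + gop v x)// /gop derive1ZD// H1 H2.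
rewrite [(a *: u + v) _](_ : _ = a * u (x - 1) + v (x - 1))//.
move: (Rintegral _ _ _) (Rintegral _ _ _) (Rintegral _ _ _) (Rintegral _ _ _).
by move=> *; ring.
Qed.

Lemma gopZ (a : R) (u : R -> R) : Cb1 u -> gop (a *: u) = a *: gop u.
Proof.
move=> Cu; have := @gopZD 1 0 0 Cb1_0 Cb1_0; rewrite !scale1r addr0 => g0.
have {}g0 : gop (0 : R -> R) = 0.
  by apply: (addrI (gop (0 : R -> R))); rewrite addr0 -g0.
by have := gopZD a Cu Cb1_0; rewrite g0 !addr0.
Qed.

Lemma gop_le : exists2 C : R, 0 < C & forall u : R -> R, Cb1 u ->
  Linfty_norm (gop u) <= C * Cb1_norm u.
Proof.
pose I1 := \int[mu]_(y in `[0, 1]) w13 y; pose I2 := \int[mu]_(y in `[1, +oo[) w43 y.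
have I1_ge0 : 0 <= I1 by apply: Rintegral_ge0 => y; exact: w_ge0.
have I2_ge0 : 0 <= I2 by apply: Rintegral_ge0 => y; exact: w_ge0.
exists (I1 + 1 + 1 / 3 * I2).
  by rewrite ltr_pwDl ?mulr_ge0// ltr_wpDl.
move=> u [du Cu Cu']; apply: Linfty_norm_le => x.
have H1 := kernel_le (measurable_itv _) (@w_ge0 _ _) integrable_powR_01 x Cu'.
have H2 := kernel_le (measurable_itv _) (@w_ge0 _ _) integrable_powR_1y x Cu.
have H3 := Linfty_norm_ub (x - 1) Cu.2.
have n0 := Linfty_norm_ge0 Cu.2; have n1 := Linfty_norm_ge0 Cu'.2.
rewrite -/I1 in H1; rewrite -/I2 in H2.
rewrite /gop /Cb1_norm; apply: le_trans (ler_normB _ _) _.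
rewrite [X in _ + X]normrM [`|1 / 3|]ger0_norm//.
have p1 := mulr_ge0 n0 I1_ge0; have p2 := mulr_ge0 n1 I2_ge0.
suff bound (a b : R) : `|a| <= Linfty_norm u^`() * I1 -> `|b| <= Linfty_norm u * I2 ->
    `|a + u (x - 1)| + 1 / 3 * `|b| <=
    (I1 + 1 + 1 / 3 * I2) * (Linfty_norm u + Linfty_norm u^`()).
  exact: bound H1 H2.
clear H1 H2; clearbody I1 I2 => H1 H2; have := ler_normD a (u (x - 1)).
lra.
Qed.

Section wave_term.
Context (c : R).
Hypothesis c0 : 0 < c.

(** This is [2 * c - gc c x], which has derivative [- hc c] and limit 0 at
    minus infinity. Unlike [gc c], it is nonnegative together with its
    derivative, so that the integrand [h] below is nonnegative and the
    fundamental theorem applies on the half-line with no integrability to be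
    checked beforehand. *)
Let u (x : R) : R := c + tauc c x.

Let du (x : R) : is_derive x (1 : R) u (- hc c x).
Proof.
have -> : u = cst c + c \*: (fun y => tanh (c / 2 * y)).
  by apply/funext => y; rewrite /u taucE.
have d := is_derive_tanhM (c / 2) x.
by apply: is_derive_eq; rewrite hcE /GRing.scale/=; field.
Qed.

Let u' : u^`() = fun x => - hc c x.
Proof. by apply/funext => x; have d := du x; rewrite derive1E derive_val. Qed.

Let hcS : hc c = (- (c ^+ 2 / 2)) *: sech2 c.
Proof. by apply/funext => x; rewrite hcE. Qed.

Let Cb_hc : Cb (hc c).
Proof.
have [_ Cs _] := Cb1_sech2 c0.
by rewrite hcS; exact: CbZ.
Qed.

Let Cb1_u : Cb1 u.
Proof.
split; first by move=> x; have [] := du x.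
  have Cc : Cb (cst c : R -> R).
    by split=> [x|]; [exact: cvg_cst|exact: (@bounded_fun_of_le _ _ `|c|)].
  exact: (CbD Cc (Cb_tauc c0)).
rewrite u' (_ : (fun x => - hc c x) = (-1) *: hc c); first exact: CbZ.
by apply/funext => x; exact/esym/mulN1r.
Qed.

Let u_ge0 x : 0 <= u x.
Proof. by have := normr_tauc_le c0 x; rewrite ler_norml /u => /andP[]; lra. Qed.

Let hc_le0 x : hc c x <= 0.
Proof.
rewrite hcE mulNr oppr_le0; apply: mulr_ge0; last exact: sqr_ge0.
by apply: divr_ge0; first exact: sqr_ge0.
Qed.

Let u_le x : u x <= 2 * c.
Proof. by have := normr_tauc_le c0 x; rewrite ler_norml /u => /andP[]; lra. Qed.

(** The derivative in [y] of [- y `^ (- 1/3) * u (x - y)]. *)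
Let h x y := w13 y * - hc c (x - y) + 1 / 3 * (u (x - y) * w43 y).

Let integral_h x : (\int[mu]_(y in `[1%R, +oo[) (h x y)%:E = (u (x - 1)%R)%:E)%E.
Proof.
pose H : R -> R := - ((fun y => y `^ (- (1 / 3))) * (fun y => u (x - y))).
have dux (y : R) : is_derive y (1 : R) (fun y => u (x - y)) (hc c (x - y)).
  have ds : is_derive y (1 : R) (fun y => x - y) (-1).
    have : is_derive y (1 : R) (cst x - id) (0 - 1) by exact: is_deriveB.
    by rewrite sub0r.
  have := @is_derive1_comp _ u (fun y => x - y) y _ _ (du (x - y)) ds.
  by rewrite mulrN1 opprK.
have dH (y : R) : 0 < y -> is_derive y (1 : R) H (h x y).
  move=> y0; have d1 := is_derive_powR_pos (- (1 / 3)) y0; have d2 := dux y.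
  apply: is_derive_eq; rewrite /h /GRing.scale/= -!powRN.
  have -> : - (4 / 3) = - (1 / 3) - 1 :> R by field.
  by move: (y `^ _) (y `^ _) => z1 z2; field.
have cH (y : R) : 0 < y -> {for y, continuous H}.
  by move=> y0; apply/differentiable_continuous/derivable1_diffP; have [] := dH _ y0.
have w_cont (r y : R) : 0 < y -> (z `^ r)^-1 @[z --> y] --> (y `^ r)^-1.
  move=> y0; rewrite -powRN; under eq_fun do rewrite -powRN.
  exact: continuous_powR_pos.
rewrite (@ge0_continuous_FTC2y _ (h x) H 1 0).
- rewrite -EFinB sub0r; congr EFin.
  by rewrite (_ : H 1 = - (1 `^ (- (1 / 3)) * u (x - 1)))// powR1 mul1r opprK.
- move=> y _; rewrite /h addr_ge0// mulr_ge0 ?mulr_ge0 ?oppr_ge0 ?u_ge0//; exact: (@w_ge0 setT).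
- apply: continuous_in_subspaceT => y; rewrite inE/= in_itv/= andbT => y1.
  have y0 : 0 < y by exact: lt_le_trans y1.
  apply: cvgD; apply: cvgM.
  + exact: w_cont.
  + by apply: cvgN; apply: continuous_reflection; case: Cb_hc.
  + exact: cvg_cst.
  + apply: cvgM; last exact: w_cont.
    by apply: continuous_reflection; have [_ []] := Cb1_u.
- have H0 : 2 * c * (y `^ (1 / 3))^-1 @[y --> +oo] --> 2 * c * 0.
    by apply: cvgM; [exact: cvg_cst|apply: cvg_powR_inv_pinfty; rewrite divr_gt0].
  rewrite mulr0 in H0; apply/norm_cvg0P.
  apply: (squeeze_cvgr _ (cvg_cst 0) H0); near=> y; rewrite normr_ge0/=.
  rewrite (_ : H y = - (y `^ (- (1 / 3)) * u (x - y)))// normrN powRN mulrC.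
  rewrite ger0_norm ?mulr_ge0 ?invr_ge0 ?powR_ge0// ler_wpM2r ?invr_ge0 ?powR_ge0//.
- by move=> y y1; have [] := dH y (lt_trans ltr01 y1).
- by apply: cvg_at_right_filter; exact: cH.
- move=> y; rewrite in_itv/= andbT => y1.
  by have d := dH y (lt_trans ltr01 y1); rewrite derive1E derive_val.
Unshelve. all: by end_near. Qed.


Let h_ge0 x y : 0 <= h x y.
Proof.
by rewrite /h addr_ge0// mulr_ge0 ?mulr_ge0 ?oppr_ge0 ?u_ge0//; exact: (@w_ge0 setT).
Qed.

Let integrable_uw x : mu.-integrable `[1, +oo[ (EFin \o (fun y => u (x - y) * w43 y)).
Proof.
apply: (integrable_kernel (measurable_itv _) integrable_powR_1y).
by have [] := Cb1_u.
Qed.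

Let measurable_shift (v : R -> R) (x : R) : continuous v ->
  measurable_fun setT (fun y : R => v (x - y)).
Proof.
by move=> cv; apply: continuous_measurable_fun; exact: continuous_reflection.
Qed.

Let integrable_h x : mu.-integrable `[1, +oo[ (EFin \o h x).
Proof.
apply/integrableP; split.
  apply/measurable_EFinP; apply: measurable_funTS; apply: measurable_funD.
    apply: measurable_funM; first exact: measurable_powR_inv.
    by apply: measurableT_comp => //; apply: measurable_shift; case: Cb_hc.
  apply: measurable_funM => //; apply: measurable_funM; last exact: measurable_powR_inv.
  by apply: measurable_shift; have [_ []] := Cb1_u.
under eq_integral do rewrite gee0_abs ?lee_fin ?h_ge0//.
by rewrite integral_h ltry.
Qed.

Let mI : measurable (`[1 : R, +oo[%classic : set (measurableTypeR R)).
Proof. exact: measurable_itv. Qed.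

Let tail_integrable x : mu.-integrable `[1, +oo[ (EFin \o (fun y => hc c (x - y) * w13 y)).
Proof.
have uw := integrableZl mI (1 / 3) (integrable_uw x).
have := integrableB mI uw (integrable_h x).
apply: eq_integrable => // y _; rewrite /= -EFinM -EFinB; congr EFin.
by rewrite /h/=; ring.
Qed.

Let tail_integral x : \int[mu]_(y in `[1, +oo[) (hc c (x - y) * w13 y) =
  1 / 3 * (\int[mu]_(y in `[1, +oo[) (u (x - y) * w43 y)) - u (x - 1).
Proof.
have uw := integrableZl mI (1 / 3) (integrable_uw x).
have -> : u (x - 1) = \int[mu]_(y in `[1, +oo[) (h x y) by rewrite /Rintegral integral_h.
rewrite -(RintegralZl _ mI (integrable_uw x)) -(RintegralB mI uw (integrable_h x)).
by apply: eq_Rintegral => y _; rewrite /h/=; ring.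
Qed.

(** Integration by parts on [1, +oo[: [integral_h] expresses the tail of the
    convolution through the terms of [gop u], and on [0, 1] the two integrands
    agree up to sign since [u' = - hc c]. *)
Lemma wave_convolutionE : convolution (@psi R) (hc c) = (-1) *: gop u.
Proof.
apply/funext => x.
pose f y := hc c (x - y) * w13 y.
have m01 : measurable (`[0 : R, 1]%classic : set (measurableTypeR R)) by exact: measurable_itv.
have m1y : measurable (`]1 : R, +oo[%classic : set (measurableTypeR R)) by exact: measurable_itv.
have if1 : mu.-integrable `[0, 1] (EFin \o f).
  exact: (integrable_kernel (measurable_itv _) integrable_powR_01 x Cb_hc).
have if2 : mu.-integrable `]1, +oo[ (EFin \o f).
  apply: integrableS (tail_integrable x) => //.
  by apply: subset_itvr; rewrite bnd_simp.
have -> : convolution (@psi R) (hc c) x =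
    \int[mu]_y ((f \_ `[0, 1]) y + (f \_ `]1, +oo[) y).
  apply: eq_Rintegral => y _; rewrite /psi !patchE indicE powRN /f.
  rewrite !mem_setE !in_itv/= !andbT (_ : point = 0 :> R)//.
  have [y0|y0|<-] := ltgtP 0 y.
  - rewrite [true%:R * _](_ : _ = (y `^ (1 / 3))^-1); last exact: mul1r.
    have [y1|y1] := leP y 1; first by rewrite addr0 mulrC.
    by rewrite add0r mulrC.
  - by rewrite !mul0r add0r ltNge (le_trans (ltW y0))//= addr0.
  (* At [y = 0] both sides are 0, by the convention for the inverse of 0. *)
  - by rewrite ler01 ltNge ler01 /= !mul0r powR0 ?invr0 ?mulr0 ?addr0// mulf_neq0.
rewrite RintegralD//.
- rewrite -!Rintegral_mkcond Rintegral_itv_obnd_cbnd// tail_integral.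
  rewrite [RHS](_ : _ = - gop u x); last exact: mulN1r.
  have -> : gop u x = - (\int[mu]_(y in `[0, 1]) f y) + u (x - 1)
      - 1 / 3 * \int[mu]_(y in `[1, +oo[) (u (x - y) * w43 y).
    rewrite /gop u'; congr (_ + _ - _); rewrite -mulN1r -(RintegralZl _ m01 if1).
    by apply: eq_Rintegral => y _; rewrite /f mulN1r mulNr.
  by ring.
- have := (integrable_mkcond _ m01).1 if1; rewrite restrict_EFin; exact.
- have := (integrable_mkcond _ m1y).1 if2; rewrite restrict_EFin; exact.
Qed.

Lemma Cb_wave_convolution : Cb (convolution (@psi R) (hc c)).
Proof.
by rewrite wave_convolutionE; apply: CbZ; apply: Cb_gop; exact: Cb1_u.
Qed.

End wave_term.
End nonlocal_operator.

(** * Reduction to the quadratic equation and conclusion *)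

Section inverse_operator.
Context {R : realType} (c : R).
Hypothesis c0 : 0 < c.

(** Meaningful on bounded continuous functions, where the preimage exists and
    is unique. *)
Definition linearization_inv (f : R -> R) : X c :=
  get [set phi : X c | linearization c phi = f].
Local Notation T := linearization_inv.

Lemma linearization_invK f : Cb f -> linearization c (T f) = f.
Proof.
move=> Cf; have [K _ /(_ f Cf)[phi [phiE _]]] := linearization_solvable c0.
exact: (@getPex _ [set phi : X c | linearization c phi = f] (ex_intro _ phi phiE)).
Qed.

Lemma linearization_invP f (phi : X c) : Cb f ->
  phi = T f <-> linearization c phi = f.
Proof.
move=> Cf; split=> [->|phiE]; first exact: linearization_invK.
by apply: linearization_injective => //; rewrite linearization_invK.
Qed.

Lemma linearization_invZD (a : R) (f g : R -> R) : Cb f -> Cb g ->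
  T (a *: f + g) = a *: T f + T g.
Proof.
move=> Cf Cg; apply/esym/linearization_invP; first exact: CbZD.
rewrite X_funD X_funZ linearizationZD ?linearization_invK//; exact: X_Cb1.
Qed.

Lemma linearization_invD (f g : R -> R) : Cb f -> Cb g -> T (f + g) = T f + T g.
Proof. by move=> Cf Cg; have := linearization_invZD 1 Cf Cg; rewrite !scale1r. Qed.

Lemma linearization_inv0 : T 0 = 0.
Proof.
have := linearization_invD Cb0 Cb0; rewrite addr0 => /eqP.
by rewrite -subr_eq0 opprD addrA subrr sub0r oppr_eq0 => /eqP.
Qed.

Lemma linearization_invZ (a : R) (f : R -> R) : Cb f -> T (a *: f) = a *: T f.
Proof.
move=> Cf; have := linearization_invZD a Cf Cb0.
by rewrite linearization_inv0 !addr0.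
Qed.

Lemma linearization_inv_le : exists2 C, 0 < C & forall f, Cb f ->
  `|T f| <= C * Linfty_norm f.
Proof.
have [C C0 HC] := linearization_bounded_below c0; exists C => // f Cf.
by have := HC (T f); rewrite linearization_invK.
Qed.

Let B (p q : X c) : X c := T (2^-1 *: ((p : R -> R) * (q : R -> R))).
Let A (p : X c) : X c := T (gop p).
Let K : X c := T (convolution (@psi R) (hc c)).

Lemma Cb_X (p : X c) : Cb p. Proof. by have [] := X_Cb1 p. Qed.

Lemma CbX_mul (p q : X c) : Cb ((p : R -> R) * (q : R -> R)).
Proof. by apply: CbM; exact: Cb_X. Qed.

Lemma X_ub (p : X c) x : `|p x| <= `|p|.
Proof.
have [_ [_ bp] [_ bp']] := X_Cb1 p; rewrite X_normE (le_trans (Linfty_norm_ub x bp))//.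
by rewrite lerDl Linfty_norm_ge0.
Qed.

(** Apply the inverse of [linearization] to
    [linearization phi = phi ^ 2 / 2 + e * gop phi + e * convolution psi hc]. *)
Lemma G_eq0P (e : R) (p : X c) :
  G c e p = 0 <-> p = B p p + e *: A p + e *: K.
Proof.
have Cg := Cb_gop (X_Cb1 p); have CK := Cb_wave_convolution c0.
have Cm2 := CbZ 2^-1 (CbX_mul p p).
have Ceg := CbZ e Cg; have CeK := CbZ e CK.
have C2 := CbD Cm2 Ceg; have C3 := CbD C2 CeK.
rewrite /B /A /K -!linearization_invZ// -!linearization_invD//.
split=> [G0|/(linearization_invP _ C3) L].
  apply/linearization_invP => //; apply/funext => x.
  have : G c e p x = 0 by rewrite G0.
  rewrite /G /linearization !fctE /GRing.scale/=.
  by move: (gop _ _) (convolution _ _ _) => a1 a2 H; lra.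
apply/funext => x; suff : G c e p x = 0 by [].
have /(congr1 (@^~ x)) := L.
rewrite /G /linearization !fctE /GRing.scale/=.
by move: (gop _ _) (convolution _ _ _) => a1 a2 H; lra.
Qed.

Theorem X_quadratic_branch : exists delta r : R, [/\ 0 < delta, 0 < r,
    forall e, - delta < e < delta ->
      exists! u : X c, `|u| <= r /\ u = B u u + e *: A u + e *: K
    & exists phi : R -> X c,
      (forall e, - delta < e < delta ->
        `|phi e| <= r /\ phi e = B (phi e) (phi e) + e *: A (phi e) + e *: K) /\
      smooth_on `]- delta, delta[ phi].
Proof.
have [C C0 T_le] := linearization_inv_le; have [D D0 gop_leD] := @gop_le R.
pose V : completeNormedModType R := HB.pack (X c)
  (Uniform_isComplete.Build (X c) (@X_complete R c c0)).
apply: (@quadratic_branch R V B A K C (C * D)) => //.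
- by move=> u v; rewrite /B mulrC.
- move=> u v w; rewrite /B X_funD mulrDr scalerDr.
  by rewrite linearization_invD//; apply: CbZ; exact: CbX_mul.
- move=> u a v; rewrite /B X_funZ.
  have -> : (u : R -> R) * (a *: (v : R -> R)) = a *: ((u : R -> R) * (v : R -> R)).
    by apply/funext => x; exact: mulrCA.
  rewrite scalerA mulrC -scalerA.
  by rewrite linearization_invZ//; apply: CbZ; exact: CbX_mul.
- move=> u v; apply: le_trans (T_le _ (CbZ _ (CbX_mul u v))) _.
  rewrite -mulrA ler_wpM2l ?(ltW C0)//; apply: Linfty_norm_le => x.
  rewrite [X in `|X|](_ : _ = 2^-1 * (u x * v x))// !normrM.
  rewrite (@le_trans _ _ (`|u x| * `|v x|))//; last by rewrite ler_pM// X_ub.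
  by rewrite ler_piMl ?mulr_ge0// ger0_norm// invf_le1// ler1n.
- move=> u v; rewrite /A X_funD.
  have := gopZD 1 (X_Cb1 u) (X_Cb1 v); rewrite !scale1r => ->.
  by rewrite linearization_invD//; apply: Cb_gop; exact: X_Cb1.
- move=> a u; rewrite /A X_funZ gopZ; last exact: X_Cb1.
  by rewrite linearization_invZ//; apply: Cb_gop; exact: X_Cb1.
- exact: mulr_gt0.
- move=> u; apply: le_trans (T_le _ (Cb_gop (X_Cb1 u))) _.
  by rewrite -mulrA ler_wpM2l ?(ltW C0)//; apply: gop_leD; exact: X_Cb1.
Qed.

End inverse_operator.


Unset Implicit Arguments.

Theorem theorem2p1 (R : realType) (c : R) (hc0 : 0 < c) :
  exists delta delta0 : R,
    [/\ 0 < delta,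
        0 < delta0,
        forall eta : R, - delta < eta < delta ->
          exists! phi : X c, `|phi| <= delta0 /\ G c eta phi = 0
      & exists phi_ : R -> X c,
          (forall eta : R, - delta < eta < delta ->
             `|phi_ eta| <= delta0 /\ G c eta (phi_ eta) = 0) /\
          exists U : set R,
            [/\ open U, U 0, U `<=` `]- delta, delta[ & smooth_on U phi_]].
Proof.
have [delta [r [delta0 r0 uniq [phi [phiP phi_smooth]]]]] := X_quadratic_branch hc0.
exists delta, r; split=> //.
  move=> eta /uniq[u [[ur uE] u_uniq]]; exists u; split.
    by split=> //; apply/(G_eq0P hc0).
  by move=> v [vr /(G_eq0P hc0) vE]; exact: u_uniq.
exists phi; split.
  by move=> eta /phiP[phir phiE]; split=> //; apply/(G_eq0P hc0).
exists `]- delta, delta[; split=> //.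
by rewrite /= in_itv/= oppr_lt0 delta0.
Qed.
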